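(* The element $\tilde{\mathcal S}$ of the completed tensor product of $U^+$ and $\hat B^-$ satisfies $$(1\otimes e_\alpha)\,\tilde{\mathcal S}=(\mathrm{id}\otimes\tau_\alpha^{-1})(\tilde{\mathcal S})\,\tilde\Delta(e_\alpha)\qquad\text{for all }\alpha\in\Pi .$$
   Context: **Quantum group.** $\mathfrak g=\mathfrak g_-\oplus\mathfrak h\oplus\mathfrak g_+$ is a semisimple complex Lie algebra, $\Pi$ the simple roots, $\Gamma_+=\mathbb Z_+\Pi$, $(\cdot,\cdot)$ the invariant form on $\mathfrak h^*$, $\rho$ the half-sum of positive roots, $h_\lambda\in\mathfrak h$ defined by $\mu(h_\lambda)=(\mu,\lambda)$. $q\in\mathbb C^\times$ is not a root of unity and $[z]_q=\frac{q^z-q^{-z}}{q-q^{-1}}$. $U=U_q(\mathfrak g)$ is generated by $e_\alpha,f_\alpha,q^{\pm h_\alpha}$ ($\alpha\in\Pi$) with $q^{h_\alpha}e_\beta=q^{(\alpha,\beta)}e_\beta q^{h_\alpha}$, $q^{h_\alpha}f_\beta=q^{-(\alpha,\beta)}f_\beta q^{h_\alpha}$, $[e_\alpha,f_\beta]=\delta_{\alpha\beta}[h_\alpha]_q$ and the $q$-Serre relations. $U^+,U^-,U^0$ are the subalgebras generated by the $e_\alpha$, the $f_\alpha$, the $q^{\pm h_\alpha}$; $B^\pm=U^\pm U^0$. Two comultiplications: $\Delta(f_\alpha)=f_\alpha\otimes1+q^{-h_\alpha}\otimes f_\alpha$, $\Delta(e_\alpha)=e_\alpha\otimes q^{h_\alpha}+1\otimes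 e_\alpha$, and $\tilde\Delta(f_\alpha)=f_\alpha\otimes1+q^{h_\alpha}\otimes f_\alpha$, $\tilde\Delta(e_\alpha)=e_\alpha\otimes q^{-h_\alpha}+1\otimes e_\alpha$, with $q^{\pm h_\alpha}$ group-like in both. $\check{\mathcal R}=q^{-\sum_i h_i\otimes h_i}\mathcal R$ ($\{h_i\}$ an orthonormal basis of $\mathfrak h$, $\mathcal R$ the universal R-matrix for $\Delta$) is the element of the completed tensor product $\prod_{\mu\in\Gamma_+}U^+[\mu]\otimes U^-[-\mu]$ with zero-weight component $1\otimes1$ and $\check{\mathcal R}\Delta(u)=\tilde\Delta(u)\check{\mathcal R}$ for all $u\in U$. Put $\mathcal F=\frac1{q-q^{-1}}(\check{\mathcal R}-1\otimes1)$. **Localization and shifts.** $\hat U^0$ is the localization of $U^0$ at the elements $[h_\mu-c]_q$, $0\ne\mu\in\Gamma_+$, with $c$ in a fixed subset of $\mathbb C$ large enough to include all constants occurring below and their shifts by weights. $\hat B^-=U^-\hat U^0$ and $\hat U$ are the corresponding extensions of $B^-$ and $U$. For $\mu\in\mathfrak h^*$, $\tau_\mu$ is the automorphism of $\hat U^0$ with $q^{\pm h_\beta}\mapsto q^{\pm(\mu,\beta)}q^{\pm h_\beta}$, extended to an automorphism of $\hat B^-$ by $h\phi\mapsto\tau_\mu(h)\phi$ for $h\in\hat U^0$, $\phi\in U^-$ (so it is the identity on $U^-$). **The element $\tilde{\mathcal S}$.** For $\mu\in\Gamma_+$ let $\eta_\mu=h_\mu+(\mu,\rho)-\frac12(\mu,\mu)$,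 $\tilde\eta_\mu=h_\mu+(\mu,\rho)+\frac12(\mu,\mu)$, and let $\varphi(z)=q^{-z}/[z]_q$. For $\mu\neq0$ let $\varphi(-D)$ act on $U^+[\mu]\otimes\hat B^-[-\mu]$ by $x\otimes y\mapsto x\otimes\varphi(\tilde\eta_\mu)y=x\otimes y\,\varphi(\eta_\mu)$. (Here $D=\mathrm{id}\otimes[d,-]$ with $d=\frac12\sum_ih_ih_i+h_\rho$.) In the completed tensor product $\prod_{\mu\in\Gamma_+}U^+[\mu]\otimes\hat B^-[-\mu]$ define $\tilde{\mathcal S}=\sum_{n\ge0}\tilde{\mathcal S}^{(n)}$ with $\tilde{\mathcal S}^{(0)}=1\otimes1$ and $\tilde{\mathcal S}^{(n+1)}=\varphi(-D)(\tilde{\mathcal S}^{(n)}\mathcal F)$. The identity in the claim holds in the completed tensor product $\prod_{\mu\in\Gamma_+}U^+[\mu]\otimes\hat U$. *)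

(* Defs.v *)
From HB Require Import structures.
From mathcomp Require Import all_boot all_order all_algebra.
From mathcomp Require Import complex.
From mathcomp Require Import boolp classical_sets functions cardinality fsbigop.
From mathcomp Require Import reals sequences exp trigo.

Set Implicit Arguments.
Unset Strict Implicit.
Unset Printing Implicit Defensive.
Import Order.TTheory GRing.Theory Num.Theory.
Local Open Scope classical_set_scope.
Local Open Scope ring_scope.
Local Open Scope quotient_scope.

(* Associative unital algebras over K.  MathComp's algType excludes the zero
   ring, but whether an algebra given by generators and relations is zero is
   not known beforehand. *)
Record algebra (K : fieldType) := Algebra {
  alg_ring : pzRingType;
  alg_scale : K -> alg_ring -> alg_ring;
  alg_scaleA : forall a b x, alg_scale a (alg_scale b x) = alg_scale (a * b) x;
  alg_scale1 : left_id 1 alg_scale;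
  alg_scaleDr : right_distributive alg_scale +%R;
  alg_scaleDl : forall x, {morph alg_scale^~ x : a b / a + b};
  alg_scaleAl : forall a x y, alg_scale a (x * y) = alg_scale a x * y;
  alg_scaleAr : forall a x y, alg_scale a (x * y) = x * alg_scale a y }.

Definition alg_sort (K : fieldType) (A : algebra K) : Type := alg_ring A.
Coercion alg_sort : algebra >-> Sortclass.

HB.instance Definition _ (K : fieldType) (A : algebra K) :=
  GRing.PzRing.copy (alg_sort A) (alg_ring A).
HB.instance Definition _ (K : fieldType) (A : algebra K) :=
  GRing.Zmodule_isLmodule.Build K (alg_sort A) (@alg_scaleA K A)
    (@alg_scale1 K A) (@alg_scaleDr K A) (@alg_scaleDl K A).

Lemma ascalerAl (K : fieldType) (A : algebra K) (a : K) (x y : A) :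
  a *: (x * y) = (a *: x) * y.
Proof. exact: alg_scaleAl. Qed.

Lemma ascalerAr (K : fieldType) (A : algebra K) (a : K) (x y : A) :
  a *: (x * y) = x * (a *: y).
Proof. exact: alg_scaleAr. Qed.

Definition is_alghom (K : fieldType) (A B : algebra K) (f : A -> B) : Prop :=
  [/\ linear f, f 1 = 1 & {morph f : x y / x * y}].

Section Alghom.
Variables (K : fieldType) (A B : algebra K) (f : A -> B).
Hypothesis hf : is_alghom f.

Lemma alghom1 : f 1 = 1. Proof. by case: hf. Qed.
Lemma alghomM : {morph f : x y / x * y}. Proof. by case: hf. Qed.
Lemma alghomP a x y : f (a *: x + y) = a *: f x + f y.
Proof. by case: hf => h _ _; apply: h. Qed.
Lemma alghom0 : f 0 = 0.
Proof. by have := alghomP (-1) 0 0; rewrite !scaleN1r !addNr. Qed.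
Lemma alghomZ a x : f (a *: x) = a *: f x.
Proof. by rewrite -[a *: x]addr0 alghomP alghom0 addr0. Qed.
Lemma alghomD : {morph f : x y / x + y}.
Proof. by move=> x y; have := alghomP 1 x y; rewrite !scale1r. Qed.
Lemma alghomN : {morph f : x / - x}.
Proof. by move=> x; rewrite -!scaleN1r alghomZ. Qed.
Lemma alghomX m : {morph f : x / x ^+ m}.
Proof. by move=> x; elim: m => [|m IH]; rewrite ?alghom1 // !exprS alghomM IH. Qed.
Lemma alghom_sum (I : Type) (r : seq I) (P : pred I) (F : I -> A) :
  f (\sum_(i <- r | P i) F i) = \sum_(i <- r | P i) f (F i).
Proof. by apply: (big_morph f); [exact: alghomD|exact: alghom0]. Qed.
Lemma alghom_prod (I : Type) (r : seq I) (P : pred I) (F : I -> A) :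
  f (\prod_(i <- r | P i) F i) = \prod_(i <- r | P i) f (F i).
Proof. by apply: (big_morph f); [exact: alghomM|exact: alghom1]. Qed.

End Alghom.

Definition inverse_of (A : pzRingType) (x : A) : A :=
  xget 0 [set y | x * y = 1 /\ y * x = 1].

Section Presented.

Inductive term (K G : Type) :=
  | TGen of G | TScal of K
  | TAdd of term K G & term K G | TMul of term K G & term K G.

Variables (K : fieldType) (G : Type).

HB.instance Definition _ := gen_eqMixin (term K G).
HB.instance Definition _ := gen_choiceMixin (term K G).

Fixpoint teval (A : algebra K) (g : G -> A) (t : term K G) : A :=
  match t with
  | TGen x => g x
  | TScal c => c *: (1 : A)
  | TAdd t1 t2 => teval g t1 + teval g t2
  | TMul t1 t2 => teval g t1 * teval g t2
  end.

(* The algebra generated by G subject to the relations P: noncommutative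
   polynomials modulo the identities valid in every algebra in which the
   images of the generators satisfy P.  When P is a conjunction of equations,
   this is the quotient of the free algebra by the two-sided ideal they
   generate. *)
Variable P : forall A : algebra K, (G -> A) -> Prop.

Definition pres_eq (t1 t2 : term K G) : bool :=
  `[< forall (A : algebra K) (g : G -> A), P g -> teval g t1 = teval g t2 >].

Lemma pres_eq_refl : reflexive pres_eq.
Proof. by move=> t; apply/asboolP. Qed.

Lemma pres_eq_sym : symmetric pres_eq.
Proof. by move=> t u; apply/asbool_equiv_eq; split=> h A g Pg; rewrite h. Qed.

Lemma pres_eq_trans : transitive pres_eq.
Proof.
move=> t u v /asboolP h1 /asboolP h2; apply/asboolP => A g Pg.
by rewrite h1 // h2.
Qed.

Canonical pres_equiv := EquivRel pres_eq pres_eq_refl pres_eq_sym pres_eq_trans.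

Definition pres_type := {eq_quot pres_equiv}.
HB.instance Definition _ := Choice.on pres_type.

Definition plift (A : algebra K) (g : G -> A) (x : pres_type) : A :=
  teval g (repr x).

Lemma plift_pi (A : algebra K) (g : G -> A) t :
  P g -> plift g (\pi_pres_type t) = teval g t.
Proof.
move=> Pg; rewrite /plift; have : repr (\pi_pres_type t) = t %[mod pres_type].
  by rewrite reprK.
by move=> /eqmodP/asboolP; apply.
Qed.

Lemma pres_typeP (x y : pres_type) :
  (forall (A : algebra K) (g : G -> A), P g ->
     plift g x = plift g y) -> x = y.
Proof.
by move=> h; rewrite -[x]reprK -[y]reprK; apply/eqmodP/asboolP => A g /h.
Qed.

Let padd (x y : pres_type) : pres_type := \pi_pres_type (TAdd (repr x) (repr y)).
Let pmul (x y : pres_type) : pres_type := \pi_pres_type (TMul (repr x) (repr y)).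
Let pscal (a : K) (x : pres_type) : pres_type := \pi_pres_type (TMul (TScal G a) (repr x)).
Let pconst (a : K) : pres_type := \pi_pres_type (TScal G a).

Let paddE (A : algebra K) (g : G -> A) x y : P g ->
  plift g (padd x y) = plift g x + plift g y.
Proof. by move=> Pg; rewrite plift_pi. Qed.

Let pmulE (A : algebra K) (g : G -> A) x y : P g ->
  plift g (pmul x y) = plift g x * plift g y.
Proof. by move=> Pg; rewrite plift_pi. Qed.

Let pscalE (A : algebra K) (g : G -> A) a x : P g ->
  plift g (pscal a x) = a *: plift g x.
Proof. by move=> Pg; rewrite plift_pi //= -ascalerAl mul1r. Qed.

Let pconstE (A : algebra K) (g : G -> A) a : P g ->
  plift g (pconst a) = a *: (1 : A).
Proof. by move=> Pg; rewrite plift_pi. Qed.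

Let pE := (paddE, pmulE, pscalE, pconstE, scale0r, scale1r).

Let paddA : associative padd.
Proof. by move=> x y z; apply: pres_typeP => A g Pg; rewrite !pE // addrA. Qed.
Let paddC : commutative padd.
Proof. by move=> x y; apply: pres_typeP => A g Pg; rewrite !pE // addrC. Qed.
Let padd0 : left_id (pconst 0) padd.
Proof. by move=> x; apply: pres_typeP => A g Pg; rewrite !pE // add0r. Qed.
Let paddN : left_inverse (pconst 0) (pscal (-1)) padd.
Proof. by move=> x; apply: pres_typeP => A g Pg; rewrite !pE // scaleN1r addNr. Qed.

HB.instance Definition _ := GRing.isZmodule.Build pres_type paddA paddC padd0 paddN.

Let pmulA : associative pmul.
Proof. by move=> x y z; apply: pres_typeP => A g Pg; rewrite !pE // mulrA. Qed.
Let pmul1 : left_id (pconst 1) pmul.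
Proof. by move=> x; apply: pres_typeP => A g Pg; rewrite !pE // mul1r. Qed.
Let pmulr1 : right_id (pconst 1) pmul.
Proof. by move=> x; apply: pres_typeP => A g Pg; rewrite !pE // mulr1. Qed.
Let pmulDl : left_distributive pmul +%R.
Proof. by move=> x y z; apply: pres_typeP => A g Pg; rewrite !pE // mulrDl. Qed.
Let pmulDr : right_distributive pmul +%R.
Proof. by move=> x y z; apply: pres_typeP => A g Pg; rewrite !pE // mulrDr. Qed.

HB.instance Definition _ :=
  GRing.Zmodule_isPzRing.Build pres_type pmulA pmul1 pmulr1 pmulDl pmulDr.

Let pscalA a b x : pscal a (pscal b x) = pscal (a * b) x.
Proof. by apply: pres_typeP => A g Pg; rewrite !pE // scalerA. Qed.
Let pscal1 : left_id 1 pscal.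
Proof. by move=> x; apply: pres_typeP => A g Pg; rewrite !pE. Qed.
Let pscalDr : right_distributive pscal +%R.
Proof. by move=> a x y; apply: pres_typeP => A g Pg; rewrite !pE // scalerDr. Qed.
Let pscalDl x : {morph pscal^~ x : a b / a + b}.
Proof. by move=> a b; apply: pres_typeP => A g Pg; rewrite !pE // scalerDl. Qed.

HB.instance Definition _ :=
  GRing.Zmodule_isLmodule.Build K pres_type pscalA pscal1 pscalDr pscalDl.

Let pscalAl (a : K) (x y : pres_type) : a *: (x * y) = (a *: x) * y.
Proof. by apply: pres_typeP => A g Pg; rewrite !pE // ascalerAl. Qed.
Let pscalAr (a : K) (x y : pres_type) : a *: (x * y) = x * (a *: y).
Proof. by apply: pres_typeP => A g Pg; rewrite !pE // ascalerAr. Qed.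

Definition pres : algebra K := @Algebra K pres_type *:%R
  (@scalerA K pres_type) (@scale1r K pres_type) (@scalerDr K pres_type)
  (fun x a b => @scalerDl K pres_type x a b)
  pscalAl pscalAr.

Definition pgen (x : G) : pres := \pi_pres_type (TGen K x).
Definition pres_lift (A : algebra K) (g : G -> A) : pres -> A := plift g.

Lemma presP (x y : pres) :
  (forall (A : algebra K) (g : G -> A), P g -> pres_lift g x = pres_lift g y) ->
  x = y.
Proof. exact: pres_typeP. Qed.

Lemma pres_lift_gen (A : algebra K) (g : G -> A) x :
  P g -> pres_lift g (pgen x) = g x.
Proof. by move=> Pg; rewrite /pres_lift plift_pi. Qed.

Lemma pres_lift_alghom (A : algebra K) (g : G -> A) :
  P g -> is_alghom (pres_lift g).
Proof.
move=> Pg; split => [a x y||x y]; rewrite /pres_lift.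
- by rewrite paddE // pscalE.
- by rewrite pconstE // scale1r.
- by rewrite pmulE.
Qed.

End Presented.

Section Subalgebra.
Variables (K : fieldType) (A : algebra K) (S : set A).

Inductive generated : A -> Prop :=
  | gen_in x : S x -> generated x
  | gen_one : generated 1
  | gen_lin a x y : generated x -> generated y -> generated (a *: x + y)
  | gen_mul x y : generated x -> generated y -> generated (x * y).

Definition gen_pred : {pred A} := fun x => `[< generated x >].

Lemma gen_predP x : reflect (generated x) (x \in gen_pred).
Proof. exact: asboolP. Qed.

Let gen0 : generated 0.
Proof. by rewrite -(addNr 1) -scaleN1r; apply: gen_lin; apply: gen_one. Qed.

Let gen_submod : submod_closed gen_pred.
Proof.
split; first exact/gen_predP.
by move=> a x y /gen_predP gx /gen_predP gy; apply/gen_predP/gen_lin.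
Qed.

Let gen_mulc : mulr_closed gen_pred.
Proof.
split; first by apply/gen_predP/gen_one.
by move=> x y /gen_predP gx /gen_predP gy; apply/gen_predP/gen_mul.
Qed.

HB.instance Definition _ := GRing.isSubmodClosed.Build K A gen_pred gen_submod.
HB.instance Definition _ := GRing.isMulClosed.Build A gen_pred gen_mulc.

Record subalg_type := SubAlg { subalg_val : A; _ : subalg_val \in gen_pred }.

HB.instance Definition _ := [isSub for subalg_val].
HB.instance Definition _ := [Choice of subalg_type by <:].
HB.instance Definition _ := [SubChoice_isSubZmodule of subalg_type by <:].
HB.instance Definition _ := 
  GRing.SubZmodule_isSubPzRing.Build A gen_pred subalg_type
    (GRing.subringClosedP _).
HB.instance Definition _ := [SubZmodule_isSubLmodule of subalg_type by <:].

Let sscalAl (a : K) (x y : subalg_type) : a *: (x * y) = (a *: x) * y.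
Proof. by apply: val_inj; rewrite /= ascalerAl. Qed.
Let sscalAr (a : K) (x y : subalg_type) : a *: (x * y) = x * (a *: y).
Proof. by apply: val_inj; rewrite /= ascalerAr. Qed.

Definition subalg : algebra K := @Algebra K subalg_type *:%R
  (@scalerA K subalg_type) (@scale1r K subalg_type) (@scalerDr K subalg_type)
  (fun x a b => @scalerDl K subalg_type x a b)
  sscalAl sscalAr.

Definition sincl : subalg -> A := subalg_val.

Let sincl_linear : linear sincl.
Proof. by []. Qed.
HB.instance Definition _ :=
  GRing.isLinear.Build K subalg A *:%R sincl sincl_linear.

Definition sgen (x : A) (Sx : S x) : subalg :=
  SubAlg (introT (gen_predP x) (gen_in Sx)).

End Subalgebra.

Section Tensor.
Variables (K : fieldType) (A B : algebra K).

Definition is_bilinear (W : lmodType K) (f : A -> B -> W) : Prop :=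
  (forall a, linear (f a)) /\ (forall b, linear (f^~ b)).

Definition tsum (W : zmodType) (f : A -> B -> W) (s : seq (A * B)) : W :=
  \sum_(p <- s) f p.1 p.2.

(* A (x) B: formal sums of pairs, identified when no bilinear map into any
   vector space separates them. *)
Definition tens_eq (s t : seq (A * B)) : bool :=
  `[< forall (W : lmodType K) (f : A -> B -> W), is_bilinear f ->
        tsum f s = tsum f t >].

Lemma tens_eq_refl : reflexive tens_eq.
Proof. by move=> t; apply/asboolP. Qed.

Lemma tens_eq_sym : symmetric tens_eq.
Proof. by move=> t u; apply/asbool_equiv_eq; split=> h W f Pf; rewrite h. Qed.

Lemma tens_eq_trans : transitive tens_eq.
Proof.
move=> t u v /asboolP h1 /asboolP h2; apply/asboolP => W f Pf.
by rewrite h1 // h2.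
Qed.

Canonical tens_equiv := EquivRel tens_eq tens_eq_refl tens_eq_sym tens_eq_trans.

Definition tens := {eq_quot tens_equiv}.
HB.instance Definition _ := Choice.on tens.

Definition tpure (a : A) (b : B) : tens := \pi_tens [:: (a, b)].

Definition tlift (W : zmodType) (f : A -> B -> W) (x : tens) : W :=
  tsum f (repr x).

Lemma tlift_pi (W : lmodType K) (f : A -> B -> W) s :
  is_bilinear f -> tlift f (\pi_tens s) = tsum f s.
Proof.
move=> Pf; rewrite /tlift; have : repr (\pi_tens s) = s %[mod tens].
  by rewrite reprK.
by move=> /eqmodP/asboolP; apply.
Qed.

Lemma tensP (x y : tens) :
  (forall (W : lmodType K) (f : A -> B -> W), is_bilinear f ->
     tlift f x = tlift f y) -> x = y.
Proof.
by move=> h; rewrite -[x]reprK -[y]reprK; apply/eqmodP/asboolP => W f /h.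
Qed.

Let tzero : tens := \pi_tens [::].
Let tadd (x y : tens) : tens := \pi_tens (repr x ++ repr y).
Let tscal (a : K) (x : tens) : tens :=
  \pi_tens [seq (a *: p.1, p.2) | p <- repr x].

Let tzeroE (W : lmodType K) (f : A -> B -> W) : is_bilinear f ->
  tlift f tzero = 0.
Proof. by move=> Pf; rewrite tlift_pi // /tsum big_nil. Qed.

Let taddE (W : lmodType K) (f : A -> B -> W) x y : is_bilinear f ->
  tlift f (tadd x y) = tlift f x + tlift f y.
Proof. by move=> Pf; rewrite tlift_pi // /tsum big_cat. Qed.

Lemma bilinZl (W : lmodType K) (f : A -> B -> W) a x y : is_bilinear f ->
  f (a *: x) y = a *: f x y.
Proof.
move=> [_ /(_ y) h]; have f0 : f 0 y = 0.
  by have := h (-1) 0 0; rewrite scaler0 addr0 scaleN1r addNr.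
by have := h a x 0; rewrite !addr0 f0 addr0.
Qed.

Let tscalE (W : lmodType K) (f : A -> B -> W) a x : is_bilinear f ->
  tlift f (tscal a x) = a *: tlift f x.
Proof.
move=> Pf; rewrite tlift_pi // /tlift /tsum big_map scaler_sumr.
by apply: eq_bigr => p _; rewrite bilinZl.
Qed.

Let tE := (tzeroE, taddE, tscalE).

Let taddA : associative tadd.
Proof. by move=> x y z; apply: tensP => W f Pf; rewrite !tE // addrA. Qed.
Let taddC : commutative tadd.
Proof. by move=> x y; apply: tensP => W f Pf; rewrite !tE // addrC. Qed.
Let tadd0 : left_id tzero tadd.
Proof. by move=> x; apply: tensP => W f Pf; rewrite !tE // add0r. Qed.
Let taddN : left_inverse tzero (tscal (-1)) tadd.
Proof. by move=> x; apply: tensP => W f Pf; rewrite !tE // scaleN1r addNr. Qed.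

HB.instance Definition _ := GRing.isZmodule.Build tens taddA taddC tadd0 taddN.

Let tscalA a b x : tscal a (tscal b x) = tscal (a * b) x.
Proof. by apply: tensP => W f Pf; rewrite !tE // scalerA. Qed.
Let tscal1 : left_id 1 tscal.
Proof. by move=> x; apply: tensP => W f Pf; rewrite !tE // scale1r. Qed.
Let tscalDr : right_distributive tscal +%R.
Proof. by move=> a x y; apply: tensP => W f Pf; rewrite !tE // scalerDr. Qed.
Let tscalDl x : {morph tscal^~ x : a b / a + b}.
Proof. by move=> a b; apply: tensP => W f Pf; rewrite !tE // scalerDl. Qed.

HB.instance Definition _ :=
  GRing.Zmodule_isLmodule.Build K tens tscalA tscal1 tscalDr tscalDl.

Lemma tlift_linear (W : lmodType K) (f : A -> B -> W) :
  is_bilinear f -> linear (tlift f).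
Proof. by move=> Pf a x y; rewrite taddE // tscalE. Qed.

Lemma tlift_pure (W : lmodType K) (f : A -> B -> W) a b :
  is_bilinear f -> tlift f (tpure a b) = f a b.
Proof. by move=> Pf; rewrite tlift_pi // /tsum big_seq1. Qed.

Lemma tpure_bilinear : is_bilinear tpure.
Proof.
split=> [a c x y|b c x y]; apply: tensP => W f Pf;
  rewrite (tlift_linear Pf) !tlift_pure //; [exact: Pf.1|exact: Pf.2].
Qed.

(* P (x) Q as a subspace of A (x) B, for subspaces P and Q. *)
Definition tens_in (P : A -> Prop) (Q : B -> Prop) (x : tens) : Prop :=
  exists s : seq (A * B),
    (forall p, p \in s -> P p.1 /\ Q p.2) /\
    x = \sum_(p <- s) tpure p.1 p.2.

End Tensor.

Notation "x '\ox' y" := (tpure x y) (at level 40, no associativity).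

Section TensorMap.
Variables (K : fieldType) (A B A' B' : algebra K).
Variables (f : {linear A -> A'}) (g : {linear B -> B'}).

Definition tens_map : tens A B -> tens A' B' :=
  tlift (fun a b => f a \ox g b).

Let bil : is_bilinear (fun a b => f a \ox g b).
Proof.
split=> [a c x y|b c x y]; rewrite linearP.
  exact: (tpure_bilinear A' B').1.
exact: (tpure_bilinear A' B').2.
Qed.

HB.instance Definition _ := GRing.isLinear.Build K (tens A B) (tens A' B') *:%R
  tens_map (tlift_linear bil).

Lemma tens_map_pure a b : tens_map (a \ox b) = f a \ox g b.
Proof. exact: tlift_pure. Qed.

End TensorMap.

Section TensorAlg.
Variables (K : fieldType) (A B : algebra K).
Local Notation T := (tens A B).

Let tone : T := 1 \ox 1.

Let rmulf (y : T) (a : A) (b : B) : T :=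
  tlift (fun a' b' => (a * a') \ox (b * b')) y.

Definition tens_mul (x y : T) : T := tlift (rmulf y) x.

Let bil1 a b : is_bilinear (fun a' b' => (a * a') \ox (b * b') : T).
Proof.
split=> [x c y z|x c y z]; rewrite mulrDr -ascalerAr.
  exact: (tpure_bilinear A B).1.
exact: (tpure_bilinear A B).2.
Qed.

Lemma tensE (x : T) : exists s : seq (A * B), x = \sum_(p <- s) p.1 \ox p.2.
Proof.
exists (repr x); apply: tensP => W f Pf.
pose F : {linear T -> W} := HB.pack (tlift f)
  (GRing.isLinear.Build K T W *:%R (tlift f) (tlift_linear Pf)).
rewrite -[tlift f (\sum_(p <- _) _)]/(F _) linear_sum /=.
by apply: eq_bigr => p _; rewrite tlift_pure.
Qed.

Let bil2 y : is_bilinear (rmulf y).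
Proof.
have [s ->] := tensE y.
have rE a b : rmulf (\sum_(p <- s) p.1 \ox p.2) a b =
    \sum_(p <- s) ((a * p.1) \ox (b * p.2)).
  pose F : {linear T -> T} := HB.pack (tlift (fun a' b' => (a * a') \ox (b * b') : T))
    (GRing.isLinear.Build K T T *:%R _ (tlift_linear (bil1 a b))).
  rewrite -[rmulf _ _ _]/(F _) linear_sum /=.
  by apply: eq_bigr => p _; rewrite tlift_pure //; apply: bil1.
split=> [x c u v|x c u v]; rewrite !rE scaler_sumr -big_split /=;
  apply: eq_bigr => p _; rewrite mulrDl -ascalerAl.
  exact: (tpure_bilinear A B).1.
exact: (tpure_bilinear A B).2.
Qed.

Let tmulDl : left_distributive tens_mul +%R.
Proof.
move=> x y z; have := tlift_linear (bil2 z) 1 x y.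
by rewrite !scale1r.
Qed.

Let tmulZl (c : K) x y : tens_mul (c *: x) y = c *: tens_mul x y.
Proof.
have h0 : tens_mul 0 y = 0.
  by apply: (addrI (tens_mul 0 y)); rewrite -tmulDl !addr0.
have := tlift_linear (bil2 y) c x 0; rewrite -!/(tens_mul _ y).
by rewrite h0 !addr0.
Qed.

Let rmulf_linear a b : linear (fun y => rmulf y a b).
Proof. by move=> c x y; apply: tlift_linear; apply: bil1. Qed.

Let tmulr_linear x : linear (tens_mul x).
Proof.
move=> c y z; rewrite /tens_mul /tlift /tsum scaler_sumr -big_split /=.
by apply: eq_bigr => p _; rewrite rmulf_linear.
Qed.

Let tmulDr : right_distributive tens_mul +%R.
Proof. by move=> x y z; have := tmulr_linear x 1 y z; rewrite !scale1r. Qed.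

Let tmulZr (c : K) x y : tens_mul x (c *: y) = c *: tens_mul x y.
Proof.
have h0 : tens_mul x 0 = 0.
  by apply: (addrI (tens_mul x 0)); rewrite -tmulDr !addr0.
by have := tmulr_linear x c y 0; rewrite !addr0 h0 addr0.
Qed.

Lemma tens_mul_pure a b a' b' :
  tens_mul (a \ox b) (a' \ox b') = (a * a') \ox (b * b').
Proof.
by rewrite /tens_mul tlift_pure; [rewrite /rmulf tlift_pure|]; auto.
Qed.

Let tmul_sums (I : Type) (r : seq I) (F : I -> T) x :
  tens_mul x (\sum_(i <- r) F i) = \sum_(i <- r) tens_mul x (F i).
Proof.
have h0 : tens_mul x 0 = 0.
  by apply: (addrI (tens_mul x 0)); rewrite -tmulDr !addr0.
by apply: (big_morph (tens_mul x)) => // u v; rewrite tmulDr.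
Qed.

Let tmul_sumsl (I : Type) (r : seq I) (F : I -> T) y :
  tens_mul (\sum_(i <- r) F i) y = \sum_(i <- r) tens_mul (F i) y.
Proof.
have h0 : tens_mul 0 y = 0.
  by apply: (addrI (tens_mul 0 y)); rewrite -tmulDl !addr0.
by apply: (big_morph (tens_mul^~ y)) => // u v; rewrite tmulDl.
Qed.

Let tmulA : associative tens_mul.
Proof.
move=> x y z; have [r ->] := tensE x; have [s ->] := tensE y.
have [t ->] := tensE z.
rewrite !tmul_sumsl; apply: eq_bigr => p _.
have -> := tmul_sums s (fun q => q.1 \ox q.2) (p.1 \ox p.2).
rewrite tmul_sums tmul_sumsl; apply: eq_bigr => u _.
by rewrite !tmul_sums; apply: eq_bigr => v _; rewrite !tens_mul_pure !mulrA.
Qed.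

Let tmul1 : left_id tone tens_mul.
Proof.
move=> x; have [r ->] := tensE x; rewrite tmul_sums; apply: eq_bigr => p _.
by rewrite tens_mul_pure !mul1r.
Qed.

Let tmulr1 : right_id tone tens_mul.
Proof.
move=> x; have [r ->] := tensE x; rewrite tmul_sumsl; apply: eq_bigr => p _.
by rewrite tens_mul_pure !mulr1.
Qed.

HB.instance Definition _ :=
  GRing.Zmodule_isPzRing.Build T tmulA tmul1 tmulr1 tmulDl tmulDr.

Definition tensA : algebra K := @Algebra K T *:%R
  (@scalerA K T) (@scale1r K T) (@scalerDr K T)
  (fun x a b => @scalerDl K T x a b)
  (fun c x y => esym (tmulZl c x y)) (fun c x y => esym (tmulZr c x y)).

End TensorAlg.

Section RootSystem.
Variable n : nat.

(* The lattice Gamma = Z Pi: mu stands for \sum_i mu 0 i *: alpha_i. *)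
Definition lattice := 'rV[int]_n.

Definition simple (i : 'I_n) : lattice := delta_mx 0 i.

Definition in_cone (mu : lattice) : bool := [forall i, 0 <= mu 0 i].

(* Coordinates in the basis Pi of h^* (over F). *)
Definition coords (F : pzRingType) (mu : lattice) : 'rV[F]_n := map_mx intr mu.

Variable B : 'M[rat]_n.

(* The form with Gram matrix B in the basis Pi. *)
Definition form (F : unitRingType) (x y : 'rV[F]_n) : F :=
  (x *m map_mx ratr B *m y^T) 0 0.

(* Phi is the root system of a semisimple Lie algebra with base Pi, written in
   coordinates with respect to Pi, and B is an invariant form. *)
Record root_datum (Phi : seq lattice) : Prop := {
  form_sym : B^T = B;
  form_pos : forall x : 'rV[rat]_n, x != 0 -> 0 < form x x;
  roots_uniq : uniq Phi;
  roots_neq0 : 0 \notin Phi;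
  roots_simple : forall i, simple i \in Phi;
  roots_sign : forall b, b \in Phi -> in_cone b || in_cone (- b);
  roots_reduced : forall b g (c : rat), b \in Phi -> g \in Phi ->
    coords rat g = c *: coords rat b -> g = b \/ g = - b;
  roots_reflection : forall b g, b \in Phi -> g \in Phi ->
    exists k : int,
      2 * form (coords rat g) (coords rat b) =
        k%:~R * form (coords rat b) (coords rat b) /\
      g - b *~ k \in Phi }.

Definition cartan (i j : 'I_n) : int := numq (2 * B i j / B i i).

End RootSystem.

Section QuantumGroup.
Variables (R : realType) (n : nat) (B : 'M[rat]_n).
Local Notation C := (complex R).
Local Notation Gamma := (lattice n).

Definition cexp (z : C) : C :=
  Complex (expR (complex.Re z) * cos (complex.Im z))
          (expR (complex.Re z) * sin (complex.Im z)).

(* A logarithm of q, which fixes the meaning of q^z for complex z. *)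
Variable hbar : C.

Definition qpow (z : C) : C := cexp (hbar * z).
Local Notation q := (qpow 1).

Definition pairing (mu nu : Gamma) : C := form B (coords C mu) (coords C nu).

Definition qint (p : C) (m : nat) : C := (p ^+ m - p ^- m) / (p - p^-1).
Definition qfact (p : C) (m : nat) : C := \prod_(k < m) qint p k.+1.
Definition qbinom (p : C) (m k : nat) : C :=
  qfact p m / (qfact p k * qfact p (m - k)).

Definition serre (A : algebra C) (x : 'I_n -> A) (i j : 'I_n) : A :=
  let m := `|1 - cartan B i j|%N in
  let p := qpow (pairing (simple i) (simple i) / 2) in
  \sum_(k < m.+1)
    ((-1) ^+ k * qbinom p m k) *: (x i ^+ (m - k) * x j * x i ^+ k).

(* Here K i = q^{h_i} and V i = q^{- h_i}. *)
Record Uq_rel (A : algebra C) (e f K V : 'I_n -> A) : Prop := {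
  rel_KV : forall i, K i * V i = 1;
  rel_VK : forall i, V i * K i = 1;
  rel_KK : forall i j, K i * K j = K j * K i;
  rel_Ke : forall i j,
    K i * e j = qpow (pairing (simple i) (simple j)) *: (e j * K i);
  rel_Kf : forall i j,
    K i * f j = qpow (- pairing (simple i) (simple j)) *: (f j * K i);
  rel_ef : forall i j, e i * f j - f j * e i =
    if i == j then (q - q^-1)^-1 *: (K i - V i) else 0;
  rel_serre_e : forall i j, i != j -> serre e i j = 0;
  rel_serre_f : forall i j, i != j -> serre f i j = 0 }.

Inductive Ugen := GE of 'I_n | GF of 'I_n | GK of 'I_n | GV of 'I_n.

Definition U_rel (A : algebra C) (g : Ugen -> A) : Prop :=
  Uq_rel (g \o GE) (g \o GF) (g \o GK) (g \o GV).

Definition U : algebra C := pres U_rel.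

Definition Ue i : U := pgen U_rel (GE i).
Definition Uf i : U := pgen U_rel (GF i).
Definition UK i : U := pgen U_rel (GK i).
Definition UV i : U := pgen U_rel (GV i).

Section Torus.
Variables (A : algebra C) (K V : 'I_n -> A).

(* q^{h_mu + c} and [h_mu + c]_q *)
Definition qpowh (mu : Gamma) (c : C) : A :=
  qpow c *: \prod_i (if 0 <= mu 0 i then K i ^+ `|mu 0 i| else V i ^+ `|mu 0 i|).

Definition qbrack (mu : Gamma) (c : C) : A :=
  (q - q^-1)^-1 *: (qpowh mu c - qpowh (- mu) (- c)).

(* phi (h_mu + c), where phi z = q^{-z} / [z]_q *)
Definition phi (mu : Gamma) (c : C) : A :=
  qpowh (- mu) (- c) * inverse_of (qbrack mu c).

End Torus.

(* The localization inverts [h_mu - c]_q for 0 <> mu in Gamma_+ and c in X. *)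
Variable X : set C.

Definition loc_index :=
  {p : Gamma * C | [/\ in_cone p.1, p.1 != 0 & X p.2]}.

Definition Uhat_rel (A : algebra C) (g : Ugen + loc_index -> A) : Prop :=
  Uq_rel (g \o inl \o GE) (g \o inl \o GF) (g \o inl \o GK) (g \o inl \o GV) /\
  forall p : loc_index,
    let b := qbrack (g \o inl \o GK) (g \o inl \o GV)
                    (sval p).1 (- (sval p).2) in
    b * g (inr p) = 1 /\ g (inr p) * b = 1.

Definition Uhat : algebra C := pres Uhat_rel.

Definition He i : Uhat := pgen Uhat_rel (inl (GE i)).
Definition Hf i : Uhat := pgen Uhat_rel (inl (GF i)).
Definition HK i : Uhat := pgen Uhat_rel (inl (GK i)).
Definition HV i : Uhat := pgen Uhat_rel (inl (GV i)).
Definition Hinv (p : loc_index) : Uhat := pgen Uhat_rel (inr p).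

Definition Uplus : algebra C := subalg (range Ue).
Definition Uminus : algebra C := subalg (range Uf).

(* \hat B^- = U^- \hat U^0 is the subalgebra of \hat U generated by the images
   of U^- and \hat U^0. *)
Definition Bhat_gens : set Uhat :=
  range Hf `|` range HK `|` range HV `|` range Hinv.
Definition Bhat : algebra C := subalg Bhat_gens.

Definition Pe i : Uplus := sgen (imageT Ue i).

Lemma Bhat_f i : Bhat_gens (Hf i).
Proof. by do 3! left; exists i. Qed.
Lemma Bhat_K i : Bhat_gens (HK i).
Proof. by do 2! left; right; exists i. Qed.
Lemma Bhat_V i : Bhat_gens (HV i).
Proof. by left; right; exists i. Qed.

Definition Bf i : Bhat := sgen (Bhat_f i).
Definition BK i : Bhat := sgen (Bhat_K i).
Definition BV i : Bhat := sgen (Bhat_V i).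


Lemma Uhat_Uq_rel : Uq_rel He Hf HK HV.
Proof.
split=> [i|i|i j|i j|i j|i j|i j ij|i j ij]; apply: presP => A g hg;
  have hl := pres_lift_alghom hg; have [[]] := hg;
  rewrite /serre ?(alghom_sum hl) => h1 h2 h3 h4 h5 h6 h7 h8 _.
all: rewrite ?(alghom0 hl) ?(fun_if (pres_lift g)) ?(alghom0 hl) ?(alghom1 hl)
  ?(alghomD hl, alghomN hl, alghomZ hl, alghomM hl) ?(alghom0 hl)
  ?(pres_lift_gen _ hg).
- exact: h1.
- exact: h2.
- exact: h3.
- exact: h4.
- exact: h5.
- exact: h6.
- rewrite -[RHS](h7 i j ij); apply: eq_bigr => k _.
  by rewrite (alghomZ hl) !(alghomM hl) !(alghomX hl) !(pres_lift_gen _ hg).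
- rewrite -[RHS](h8 i j ij); apply: eq_bigr => k _.
  by rewrite (alghomZ hl) !(alghomM hl) !(alghomX hl) !(pres_lift_gen _ hg).
Qed.

(* The canonical homomorphism U -> \hat U. *)
Definition Ucan : U -> Uhat := pres_lift (fun y => pgen Uhat_rel (inl y)).

Lemma Ucan_alghom : is_alghom Ucan.
Proof. exact/pres_lift_alghom/Uhat_Uq_rel. Qed.

Let Ucan_linear : linear Ucan.
Proof. by case: Ucan_alghom. Qed.
HB.instance Definition _ :=
  GRing.isLinear.Build C U Uhat *:%R Ucan Ucan_linear.

Lemma Ucan_Uminus (x : U) :
  x \in gen_pred (range Uf) -> Ucan x \in gen_pred Bhat_gens.
Proof.
move=> /gen_predP; elim => {x} [_ [i _ <-]||a x y _ /gen_predP hx _ /gen_predP hy|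
  x y _ /gen_predP hx _ /gen_predP hy]; apply/gen_predP.
- rewrite [Ucan _](pres_lift_gen _ Uhat_Uq_rel); exact/gen_in/Bhat_f.
- rewrite (alghom1 Ucan_alghom); exact: gen_one.
- rewrite linearP; exact: gen_lin.
- rewrite (alghomM Ucan_alghom); exact: gen_mul.
Qed.

Definition Uminus_Bhat (x : Uminus) : Bhat :=
  SubAlg (Ucan_Uminus (valP (x : subalg_type (range Uf)))).

Let Uminus_Bhat_linear : linear Uminus_Bhat.
Proof. by move=> a x y; apply: val_inj; rewrite /= -linearP. Qed.
HB.instance Definition _ :=
  GRing.isLinear.Build C Uminus Bhat *:%R Uminus_Bhat Uminus_Bhat_linear.


(* An element of a completed tensor product \prod_mu M[mu] (x) N is the family
   of its components, extended by 0 outside Gamma_+. *)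
Definition fam_mul (T : pzRingType) (s t : Gamma -> T) : Gamma -> T :=
  fun lam => \sum_(p \in [set p : Gamma * Gamma | p.1 + p.2 = lam])
    (s p.1 * t p.2).

Definition fam_single (T : nmodType) (nu : Gamma) (x : T) : Gamma -> T :=
  fun mu => if mu == nu then x else 0.

Definition weight (nu : Gamma) (x : U) : Prop :=
  forall i, UK i * x * UV i = qpow (pairing (simple i) nu) *: x.

(* Delta is is_comult UK UV and \tilde Delta is is_comult UV UK. *)
Definition is_comult (K V : 'I_n -> U) (D : U -> tensA U U) : Prop :=
  [/\ is_alghom D,
      forall i, D (Uf i) = Uf i \ox 1 + V i \ox Uf i,
      forall i, D (Ue i) = Ue i \ox K i + 1 \ox Ue i,
      forall i, D (UK i) = UK i \ox UK i &
      forall i, D (UV i) = UV i \ox UV i].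

(* d lists the components of t in the subspaces U[nu] (x) U. *)
Definition is_decomposition (t : tens U U) (d : Gamma -> tens U U) : Prop :=
  [/\ finite_set [set nu | d nu != 0],
      forall nu, tens_in (weight nu) (fun=> True) (d nu) &
      t = \sum_(nu \in [set: Gamma]) d nu].

Definition Rcheck_UU (Rc : Gamma -> tens Uplus Uminus) : Gamma -> tens U U :=
  fun mu => tens_map (@sincl _ U (range Ue)) (@sincl _ U (range Uf)) (Rc mu).

Record is_Rcheck (D Dt : U -> tensA U U) (Rc : Gamma -> tens Uplus Uminus)
    : Prop := {
  Rcheck_out : forall mu, ~~ in_cone mu -> Rc mu = 0;
  Rcheck_weight : forall mu, in_cone mu ->
    tens_in (fun x : Uplus => weight mu (sincl x))
            (fun y : Uminus => weight (- mu) (sincl y)) (Rc mu);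
  Rcheck0 : Rc 0 = 1 \ox 1;
  Rcheck_intertwines : forall u d dt,
    is_decomposition (D u) d -> is_decomposition (Dt u) dt ->
    fam_mul (Rcheck_UU Rc) d = fam_mul dt (Rcheck_UU Rc) }.

Definition rho (Phi : seq Gamma) : 'rV[C]_n :=
  2^-1 *: \sum_(b <- Phi | in_cone b) coords C b.

(* eta_mu = h_mu + eta mu and \tilde eta_mu = h_mu + etat mu. *)
Definition eta Phi (mu : Gamma) : C :=
  form B (coords C mu) (rho Phi) - pairing mu mu / 2.
Definition etat Phi (mu : Gamma) : C :=
  form B (coords C mu) (rho Phi) + pairing mu mu / 2.

(* X contains the constants c of the [h_mu - c]_q in the denominators of
   phi (eta_mu) and phi (\tilde eta_mu), and their shifts by weights. *)
Definition admissible (Phi : seq Gamma) : Prop :=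
  (forall mu, in_cone mu -> mu != 0 -> X (- eta Phi mu) /\ X (- etat Phi mu)) /\
  (forall c mu nu, X c -> X (c + pairing mu nu)).

(* F = (Rc - 1 (x) 1) / (q - q^{-1}), in U^+ (x) \hat B^- *)
Definition Fcal (Rc : Gamma -> tens Uplus Uminus) (mu : Gamma)
    : tens Uplus Bhat :=
  (q - q^-1)^-1 *:
    tens_map idfun Uminus_Bhat (Rc mu - fam_single 0 (1 \ox 1) mu).

(* phi(-D); it is only applied to families whose component at 0 vanishes. *)
Definition phi_opD Phi (t : Gamma -> tens Uplus Bhat) : Gamma -> tens Uplus Bhat :=
  fun mu => if mu == 0 then 0
            else (1 \ox phi BK BV mu (etat Phi mu)) * t mu.

Fixpoint Stilde_n Phi Rc (m : nat) : Gamma -> tens Uplus Bhat :=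
  if m is m'.+1 then phi_opD Phi (fam_mul (Stilde_n Phi Rc m') (Fcal Rc))
  else fam_single 0 (1 \ox 1).

(* The component at mu of \sum_m S^(m), a finite sum. *)
Definition Stilde Phi Rc : Gamma -> tens Uplus Bhat :=
  fun mu => \sum_(m \in [set: nat]) Stilde_n Phi Rc m mu.

(* The automorphism tau_lam of \hat B^-, for lam in h^*. *)
Definition is_shift (lam : 'rV[C]_n) (tau : Bhat -> Bhat) : Prop :=
  [/\ is_alghom tau, bijective tau,
      forall i, tau (Bf i) = Bf i,
      forall i, tau (BK i) = qpow (form B lam (coords C (simple i))) *: BK i &
      forall i, tau (BV i) = qpow (- form B lam (coords C (simple i))) *: BV i].

(* The image of \tilde Delta (e_i) in the completion of U^+ (x) \hat U. *)
Definition Dtilde_e (i : 'I_n) : Gamma -> tens Uplus Uhat :=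
  fun mu => fam_single (simple i) (Pe i \ox HV i) mu
            + fam_single 0 (1 \ox He i) mu.

(* U^+ (x) \hat B^- -> U^+ (x) \hat U *)
Definition to_Uhat (t : Gamma -> tens Uplus Bhat) : Gamma -> tens Uplus Uhat :=
  fun mu => tens_map idfun (@sincl _ Uhat Bhat_gens) (t mu).

End QuantumGroup.

(* Main.v *)
Require Import Defs.
From mathcomp Require Import all_boot all_order all_algebra.
From mathcomp Require Import complex boolp classical_sets reals.
From HB Require Import structures.
From mathcomp Require Import cardinality fsbigop exp trigo.
From mathcomp Require Import ring lra zify.
Import Order.TTheory GRing.Theory Num.Theory.
Local Open Scope ring_scope.

Set Implicit Arguments.
Unset Strict Implicit.
Unset Printing Implicit Defensive.

(** Write R for the quasi-R-matrix and z_mu for eta-tilde_mu.  Since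
   q^(2z) - 1 = (q - q^-1) q^z [z]_q, the recursion for S = S-tilde becomes the
   ABRR equation q^(2 z_mu) S_mu = (S R)_mu with S_0 = 1.  Both sides of the
   claim, A = (1 (x) e_alpha) S and D = tau_alpha^-1(S) Delta-tilde(e_alpha),
   solve the shifted equation
     q^(2 z_mu - 2 (mu, alpha)) Z_mu = (Z R)_mu,   Z_0 = 1 (x) e_alpha:
   for A move q^(2 z_mu) past e_alpha; for D use
   Delta-tilde(e_alpha) R = R Delta(e_alpha), the weight of tau_alpha^-1(S) and
   (alpha, rho) = (alpha, alpha) / 2.  The shifted equation determines Z by
   induction on the height of mu, because q^(2 z_mu - 2 (mu, alpha)) - 1 is
   invertible for mu <> 0. *)

(** * Tensor products over a field *)

(** The twist by tau_alpha^-1 is forced. Moving q^(2 z_mu) past e_alpha costs the factor q^(2 (mu,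
    alpha)), and tau_alpha^-1 changes q^(2 z_mu) by the inverse of that factor, so both sides of the
    claim meet the same shifted equation. The term e_alpha (x) q^(h_alpha) of Delta and the term
    e_alpha (x) q^(-h_alpha) of Delta-tilde differ by q^(2 h_alpha), which makes up for the
    difference between 2 z_mu and 2 z_(mu - alpha). Two obstacles shape the rest. First, R
    intertwines the coproducts in U (x) U, while the claim lives over U-hat, and the map from U to
    its localization is not known to be injective. The bridge is U^+ (x) U: it injects into U (x) U,
    since an injective linear map has a retraction, and it maps to U^+ (x) U-hat. Second, moving
    q^(2 h_alpha) past tau_alpha^-1(S) requires the homogeneity of S; this too comes from
    uniqueness, applied to the unshifted equation. *)

Section TensorProduct.
Variable K : fieldType.

Lemma tpureDr (A B : algebra K) (a : A) (b b' : B) :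
  a \ox (b + b') = a \ox b + a \ox b'.
Proof. by have := (tpure_bilinear A B).1 a 1 b b'; rewrite !scale1r. Qed.

Lemma tpure0r (A B : algebra K) (a : A) : a \ox (0 : B) = 0.
Proof. by apply: (addrI (a \ox 0)); rewrite -tpureDr !addr0. Qed.

Lemma tpureZr (A B : algebra K) c (a : A) (b : B) :
  a \ox (c *: b) = c *: (a \ox b).
Proof.
by have := (tpure_bilinear A B).1 a c b 0; rewrite !addr0 tpure0r addr0.
Qed.

Lemma tpureNr (A B : algebra K) (a : A) (b : B) : a \ox (- b) = - (a \ox b).
Proof. by rewrite -scaleN1r tpureZr scaleN1r. Qed.

Lemma tpureM (A B : algebra K) (a a' : A) (b b' : B) :
  (a \ox b) * (a' \ox b') = (a * a') \ox (b * b') :> tens A B.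
Proof. exact: tens_mul_pure. Qed.

Lemma tpure11 (A B : algebra K) : (1 : A) \ox (1 : B) = 1 :> tens A B.
Proof. by []. Qed.

Lemma tscalerAl (A B : algebra K) c (x y : tens A B) :
  c *: (x * y) = (c *: x) * y.
Proof. exact: (@ascalerAl K (tensA A B)). Qed.

Lemma tscalerAr (A B : algebra K) c (x y : tens A B) :
  c *: (x * y) = x * (c *: y).
Proof. exact: (@ascalerAr K (tensA A B)). Qed.

(** Serves to carry q^(2 h_alpha), written as [k * k], to the left of a homogeneous element [s]. *)
Lemma tens_twist_square (A B : algebra K) c (s k t e : tens A B) :
  s * k = c *: (k * s) ->
  t * s * (k * (k * e)) = (c * c) *: (t * (k * k)) * s * e.
Proof.
move=> sk; have h x : s * (k * x) = c *: (k * (s * x)).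
  by rewrite mulrA sk -tscalerAl mulrA.
by rewrite -mulrA !h -!tscalerAr scalerA -!tscalerAl !mulrA.
Qed.

Lemma tens_mapM (A B A' B' : algebra K) (f : {linear A -> A'})
    (g : {linear B -> B'}) :
  {morph f : x y / x * y} -> {morph g : x y / x * y} ->
  {morph tens_map f g : x y / x * y}.
Proof.
move=> fM gM x y; have [s ->] := tensE x; have [t ->] := tensE y.
rewrite mulr_suml !(raddf_sum (tens_map f g)) mulr_suml; apply: eq_bigr => p _.
rewrite !mulr_sumr raddf_sum; apply: eq_bigr => r _.
by rewrite /= !tpureM !tens_map_pure tpureM fM gM.
Qed.

Lemma tens_map_comp (A1 B1 A2 B2 A3 B3 : algebra K)
    (f : {linear A2 -> A3}) (g : {linear B2 -> B3})
    (f' : {linear A1 -> A2}) (g' : {linear B1 -> B2})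
    (f'' : {linear A1 -> A3}) (g'' : {linear B1 -> B3}) :
  (forall a, f (f' a) = f'' a) -> (forall b, g (g' b) = g'' b) ->
  forall x, tens_map f g (tens_map f' g' x) = tens_map f'' g'' x.
Proof.
move=> hf hg x; have [s ->] := tensE x.
rewrite (raddf_sum (tens_map f' g')) (raddf_sum (tens_map f g)).
rewrite (raddf_sum (tens_map f'' g'')); apply: eq_bigr => p _.
by rewrite /= !tens_map_pure hf hg.
Qed.

Lemma tens_map_id (A B : algebra K) (f : {linear A -> A}) (g : {linear B -> B}) :
  (forall a, f a = a) -> (forall b, g b = b) ->
  forall x, tens_map f g x = x.
Proof.
move=> hf hg x; have [s ->] := tensE x; rewrite raddf_sum.
by apply: eq_bigr => p _; rewrite /= tens_map_pure hf hg.
Qed.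

End TensorProduct.

(** * Complements of subspaces and injectivity of tensor maps *)

Section LinearRetraction.
Local Open Scope classical_set_scope.
Variables (K : fieldType) (V W : lmodType K) (f : {linear V -> W}).

(** The empty set satisfies this, as the union of an empty chain must. That a maximal [D] contains 0
    is therefore a consequence of maximality. *)
Let indep (D : set W) :=
  (forall a x y, D x -> D y -> D (a *: x + y)) /\
  (forall v, D (f v) -> f v = 0).

Let complement : exists D : set W,
  [/\ D 0, forall a x y, D x -> D y -> D (a *: x + y),
      forall v, D (f v) -> f v = 0 & forall w, exists v, D (w - f v)].
Proof.
have [F FP Ftot|D [[Dlin Dind] Dmax]] := @Zorn_bigcup W indep.
  split=> [a x y [X FX Xx] [Y FY Yy]|v [X FX Xv]]; last exact: (FP _ FX).2.
  have [XY|YX] := Ftot _ _ FX FY.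
    by exists Y => //; apply: (FP _ FY).1 => //; apply: XY.
  by exists X => //; apply: (FP _ FX).1 => //; apply: YX.
have D0 : D 0.
  apply: contrapT => nD0; apply: (Dmax (D `|` [set 0])).
    split=> [x Dx|h]; first by left.
    by apply: nD0; apply: h; right.
  split=> [a x y [Dx|->] [Dy|->]|v [/Dind//|->//]]; rewrite ?scaler0 ?addr0 ?add0r.
  - by left; apply: Dlin.
  - left; have D00 : D 0.
      by rewrite -(addNr x) -scaleN1r; apply: Dlin.
    by have := Dlin a _ _ Dx D00; rewrite addr0.
  - by left.
  - by right.
exists D; split=> // w; apply: contrapT => nw.
have Z a x : D x -> D (a *: x) by move=> Dx; have := Dlin a x 0 Dx D0; rewrite addr0.
have S x y : D x -> D y -> D (x + y).
  by move=> Dx Dy; have := Dlin 1 x y Dx Dy; rewrite scale1r.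
(* If [w] were outside D + im f, then D + K w would be strictly larger and still meet the image
   trivially: an equation x + c w = f v with c nonzero exhibits [w] in D + im f. *)
apply: (Dmax [set x + c *: w | c in [set: K] & x in D]).
  split=> [x Dx|h]; first by exists 0 => //; exists x => //; rewrite scale0r addr0.
  apply: nw; exists 0; rewrite linear0 subr0; apply: h.
  by exists 1 => //; exists 0 => //; rewrite scale1r add0r.
split=> [a _ _ [c _ [x Dx <-]] [d _ [y Dy <-]]|v [c _ [x Dx e]]].
  exists (a * c + d) => //; exists (a *: x + y); first exact: Dlin.
  by rewrite scalerDr scalerDl addrACA scalerA.
have [c0|c0] := eqVneq c 0.
  by apply: Dind; rewrite -e c0 scale0r addr0.
case: nw; exists (c^-1 *: v).
have -> : w - f (c^-1 *: v) = - c^-1 *: x.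
  rewrite linearZ /= -e scalerDr scalerA mulVf // scale1r opprD addrC.
  by rewrite addrNK scaleNr.
exact: Z.
Qed.

Lemma linear_retraction : injective f ->
  exists g : {linear W -> V}, cancel f g.
Proof.
move=> finj; have [D [D0 Dlin Dind Dsum]] := complement.
have [g gP] := choice Dsum.
(* The component along the image is unique because D meets it trivially; linearity of [g] and the
   retraction property both follow from this. *)
have guniq w v : D (w - f v) -> g w = v.
  move=> Dv; apply: finj; apply/eqP; rewrite -subr_eq0 -linearB; apply/eqP.
  apply: Dind; rewrite linearB /=.
  have := Dlin (-1) _ _ (gP w) Dv; rewrite scaleN1r.
  by rewrite opprB addrA subrK.
have glin : linear g.
  move=> a x y; apply: guniq; rewrite linearP.
  have := Dlin a _ _ (gP x) (gP y).
  by rewrite scalerBr opprD addrACA.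
exists (HB.pack_for {linear W -> V} g (GRing.isLinear.Build K W V *:%R g glin)) => v /=.
by apply: guniq; rewrite subrr.
Qed.

End LinearRetraction.

Lemma tens_map_inj (K : fieldType) (A A' B : algebra K) (f : {linear A -> A'}) :
  injective f -> injective (tens_map f (idfun : {linear B -> B})).
Proof.
move=> /linear_retraction[g gK] x y.
move=> /(congr1 (tens_map g (idfun : {linear B -> B}))).
rewrite !(@tens_map_comp _ _ _ _ _ _ _ _ _ _ _ idfun idfun) //.
by rewrite !tens_map_id.
Qed.

(** * Families indexed by the root lattice *)

Section Cone.
Variable n : nat.
Implicit Types mu nu : lattice n.

Lemma cone0 : in_cone (0 : lattice n).
Proof. by apply/forallP => i; rewrite mxE. Qed.

Lemma cone_simple (i : 'I_n) : in_cone (simple i).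
Proof. by apply/forallP => j; rewrite mxE; case: (_ && _). Qed.

Lemma simple_neq0 (i : 'I_n) : simple i != 0.
Proof.
by apply/eqP => /matrixP /(_ 0 i); rewrite !mxE !eqxx.
Qed.

Lemma coneD mu nu : in_cone mu -> in_cone nu -> in_cone (mu + nu).
Proof.
move=> /forallP hmu /forallP hnu; apply/forallP => i; rewrite mxE.
exact: addr_ge0.
Qed.

(** Absolute values give a natural number for every [mu], fit for induction; additivity holds on the
    cone. *)
Definition height mu : nat := (\sum_i `|mu 0%R i|)%N.

Lemma heightD mu nu : in_cone mu -> in_cone nu ->
  height (mu + nu) = (height mu + height nu)%N.
Proof.
move=> /forallP hmu /forallP hnu; rewrite /height -big_split /=.
apply: eq_bigr => i _; rewrite mxE.
by apply/eqP; rewrite -eqz_nat PoszD !gez0_abs // addr_ge0.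
Qed.

Lemma height_eq0 mu : (height mu == 0%N) = (mu == 0).
Proof.
apply/idP/eqP => [|->]; last by rewrite /height big1 // => i _; rewrite mxE.
rewrite /height sum_nat_eq0 => /forallP h; apply/rowP => i; rewrite mxE.
by have := h i; rewrite absz_eq0 => /eqP.
Qed.

Lemma height_lt mu nu : in_cone nu -> in_cone (mu - nu) -> nu != mu ->
  (height nu < height mu)%N.
Proof.
move=> cnu cd ne; rewrite -[mu](subrK nu) heightD // -addn1 addnC leq_add2r.
by rewrite lt0n height_eq0 subr_eq0 eq_sym.
Qed.

(** Such [nu] have coordinates between 0 and the height of [mu], so they are coded by finite
    functions. The list [r] may contain further elements; their terms vanish in the sums. *)
Lemma cone_interval mu : exists2 r : seq (lattice n), uniq r &
  forall nu, in_cone nu -> in_cone (mu - nu) -> nu \in r.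
Proof.
exists (undup [seq \row_j (val (g j))%:Z |
  g : {ffun 'I_n -> 'I_(height mu).+1} <- enum {ffun 'I_n -> 'I_(height mu).+1}]).
  exact: undup_uniq.
move=> nu cnu cd; rewrite mem_undup; apply/mapP.
exists [ffun j => inord `|nu 0%R j|%N]; first by rewrite mem_enum.
apply/rowP => j; rewrite mxE ffunE /= inordK ?gez0_abs ?(forallP cnu) //.
rewrite ltnS -[mu](subrK nu) heightD //; apply: leq_trans (leq_addl _ _).
by rewrite /height (bigD1 j) //= leq_addr.
Qed.

End Cone.

Section Families.
Variables (n : nat) (T : pzRingType).
Implicit Types (mu nu : lattice n) (s t u F Z : lattice n -> T).

Definition cone_supported s := forall mu, ~~ in_cone mu -> s mu = 0.

(** A sum over an infinite index set is 0 by convention when its support is infinite, so every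
    computation with [fam_mul] needs a list that contains the support. *)
Lemma fam_mul_seq (r : seq (lattice n)) s t mu : uniq r ->
  (forall nu, nu \notin r -> s nu * t (mu - nu) = 0) ->
  fam_mul s t mu = \sum_(nu <- r) s nu * t (mu - nu).
Proof.
move=> ur hr; rewrite /fam_mul (fsbigE [seq (nu, mu - nu) | nu <- r]) /=.
- rewrite big_mkcond big_map; apply: eq_bigr => nu _.
  by rewrite ifT // inE /= addrC subrK.
- by rewrite map_inj_uniq // => x y [].
- by move=> _ /mapP[nu _ ->] /=; rewrite addrC subrK.
- move=> [a b] /= eab hnotin.
  have := hr a; rewrite -eab addrAC subrr add0r; apply.
  apply: contra hnotin => ar; apply/mapP; exists a => //.
  by rewrite -eab addrAC subrr add0r.
Qed.

Lemma fam_mul_cone_seq (r : seq (lattice n)) s t mu :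
  cone_supported s -> cone_supported t -> uniq r ->
  (forall nu, in_cone nu -> in_cone (mu - nu) -> nu \in r) ->
  fam_mul s t mu = \sum_(nu <- r) s nu * t (mu - nu).
Proof.
move=> cs ct ur hr; apply: fam_mul_seq => // nu; apply: contraNeq => h.
apply: hr; apply: contraNT h => nc; first by rewrite cs // mul0r.
by rewrite ct // mulr0.
Qed.

Lemma fam_mul_supported s t :
  cone_supported s -> cone_supported t -> cone_supported (fam_mul s t).
Proof.
move=> cs ct mu nmu; rewrite (fam_mul_cone_seq (r := [::])) ?big_nil //.
by move=> nu c1 c2; case/negP: nmu; rewrite -[mu](subrK nu) coneD.
Qed.

Lemma fam_single_supported nu (x : T) :
  in_cone nu -> cone_supported (fam_single nu x).
Proof.
by move=> cn mu; rewrite /fam_single; case: eqP => // ->; rewrite cn.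
Qed.

Lemma fam_mul_single0l s x mu : fam_mul (fam_single 0 x) s mu = x * s mu.
Proof.
rewrite (fam_mul_seq (r := [:: 0])) //.
  by rewrite big_seq1 /fam_single eqxx subr0.
by move=> nu; rewrite inE /fam_single => /negPf->; rewrite mul0r.
Qed.

Lemma fam_mul_two_l a x y s mu : a != 0 ->
  fam_mul (fun mu => fam_single a x mu + fam_single 0 y mu) s mu
    = x * s (mu - a) + y * s mu.
Proof.
move=> a0; rewrite (fam_mul_seq (r := [:: a; 0])) /=.
- rewrite big_cons big_seq1 /fam_single !eqxx (negPf a0) eq_sym (negPf a0).
  by rewrite addr0 add0r subr0.
- by rewrite inE a0.
- move=> nu; rewrite !inE negb_or /fam_single => /andP[/negPf-> /negPf->].
  by rewrite addr0 mul0r.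
Qed.

Lemma fam_mul_two_r a x y s mu : a != 0 ->
  fam_mul s (fun mu => fam_single a x mu + fam_single 0 y mu) mu
    = s (mu - a) * x + s mu * y.
Proof.
move=> a0; rewrite (fam_mul_seq (r := [:: mu - a; mu])) /=.
- rewrite big_cons big_seq1 /fam_single subKr subrr !eqxx (negPf a0).
  by rewrite eq_sym (negPf a0) addr0 add0r.
- by rewrite inE -subr_eq0 addrAC subrr sub0r oppr_eq0 a0.
- move=> nu; rewrite !inE negb_or /fam_single => /andP[h1 h2].
  have /negPf-> : mu - nu != a.
    by apply: contra h1 => /eqP <-; rewrite subKr.
  by rewrite subr_eq0 eq_sym (negPf h2) addr0 mulr0.
Qed.

Lemma fam_mul_shift a s t mu : in_cone a ->
  cone_supported s -> cone_supported t ->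
  fam_mul (fun nu => s (nu - a)) t mu = fam_mul s t (mu - a).
Proof.
move=> ca cs ct; have [r ur hr] := cone_interval (mu - a).
rewrite (fam_mul_cone_seq (mu := mu - a) cs ct ur hr).
rewrite (fam_mul_seq (r := [seq nu + a | nu <- r])) ?big_map.
- by apply: eq_bigr => nu _; rewrite addrK opprD addrCA addrC addrAC.
- by rewrite map_inj_uniq //; apply: addIr.
- move=> nu; apply: contraNeq => h; apply/mapP; exists (nu - a); rewrite ?subrK //.
  apply: hr; apply: contraNT h => nc; first by rewrite cs // mul0r.
  by rewrite ct ?mulr0 //; rewrite opprB addrA subrK in nc.
Qed.

Lemma fam_mul_unique (theta theta' Z Z' R : lattice n -> T) :
  cone_supported Z -> cone_supported Z' -> cone_supported R -> R 0 = 1 ->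
  (forall mu, in_cone mu -> mu != 0 -> theta' mu * (theta mu - 1) = 1) ->
  (forall mu, in_cone mu -> theta mu * Z mu = fam_mul Z R mu) ->
  (forall mu, in_cone mu -> theta mu * Z' mu = fam_mul Z' R mu) ->
  Z 0 = Z' 0 -> Z = Z'.
Proof.
move=> cZ cZ' cR R0 inv eZ eZ' Z0; apply/funext => mu.
have [N] := ubnP (height mu); elim: N mu => // N IH mu hmu.
have [cmu|ncmu] := boolP (in_cone mu); last by rewrite cZ // cZ'.
have [->//|mu0] := eqVneq mu 0.
have [r ur hr] := cone_interval mu.
have mur : mu \in r by apply: hr; rewrite // subrr cone0.
(* Since [R 0 = 1], the diagonal term of the product is [Y mu] itself. Subtracting it leaves
   [theta mu - 1] on the left and only smaller heights on the right. *)
have solve Y : cone_supported Y -> theta mu * Y mu = fam_mul Y R mu ->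
    Y mu = theta' mu * \sum_(nu <- r | nu != mu) Y nu * R (mu - nu).
  move=> cY eY; have := fam_mul_cone_seq cY cR ur hr.
  rewrite -eY (bigD1_seq mu) //= subrr R0 mulr1 => /eqP.
  rewrite addrC -subr_eq => /eqP <-.
  by rewrite -{3}[Y mu]mul1r -mulrBl mulrA inv // mul1r.
rewrite (solve _ cZ (eZ _ cmu)) (solve _ cZ' (eZ' _ cmu)); congr (_ * _).
apply: eq_bigr => nu nmu.
have [cnu|ncnu] := boolP (in_cone nu); last by rewrite cZ // cZ'.
have [cd|ncd] := boolP (in_cone (mu - nu)); last by rewrite (cR _ ncd) !mulr0.
by rewrite IH // (leq_trans (height_lt cnu cd nmu)).
Qed.

Lemma fam_mul_single0r s x mu : fam_mul s (fam_single 0 x) mu = s mu * x.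
Proof.
rewrite (fam_mul_seq (r := [:: mu])) //.
  by rewrite big_seq1 /fam_single subrr eqxx.
by move=> nu; rewrite inE /fam_single subr_eq0 eq_sym => /negPf->; rewrite mulr0.
Qed.

Lemma fam_mul0 s t : cone_supported s -> cone_supported t ->
  fam_mul s t 0 = s 0 * t 0.
Proof.
move=> cs ct; rewrite (fam_mul_cone_seq (r := [:: 0]) cs ct) ?big_seq1 ?subr0 //.
move=> nu c1 c2; rewrite inE; apply: contraT => h.
by have := height_lt c1 c2 h; rewrite /height [X in (_ < X)%N]big1 // => j _; rewrite mxE.
Qed.

(** This is associativity of the product of families around the exchange relation [h]. All four sums
    are written over the list for [mu], which also covers the interval below [mu - a]. *)
Lemma fam_mul_intertwine a (E E' G : T) s R mu : in_cone a ->
  cone_supported s -> cone_supported R ->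
  (forall nu, E * R (nu - a) + G * R nu = R (nu - a) * E' + R nu * G) ->
  fam_mul (fun nu => s (nu - a) * E + s nu * G) R mu
    = fam_mul s R (mu - a) * E' + fam_mul s R mu * G.
Proof.
move=> ca cs cR h; have [r ur hr] := cone_interval mu.
have cone_sub nu : ~~ in_cone nu -> ~~ in_cone (nu - a).
  by apply: contraNN => cn; rewrite -[nu](subrK a) coneD.
have hra nu : in_cone nu -> in_cone (mu - a - nu) -> nu \in r.
  move=> c1 c2; apply: hr => //; rewrite -[mu](subrK a) addrAC.
  exact: coneD.
have csE : cone_supported (fun nu => s nu * E).
  by move=> nu /cs->; rewrite mul0r.
have csE' : cone_supported (fun nu => s (nu - a) * E).
  by move=> nu /cone_sub/cs->; rewrite mul0r.
have csG : cone_supported (fun nu => s nu * G).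
  by move=> nu /cs->; rewrite mul0r.
rewrite (fam_mul_cone_seq (r := r)) //; last first.
  by move=> nu nc; rewrite (csE' _ nc) (csG _ nc) addr0.
under eq_bigr do rewrite mulrDl.
rewrite big_split /= -(fam_mul_cone_seq csE' cR ur hr).
rewrite (fam_mul_shift mu ca csE cR) (fam_mul_cone_seq csE cR ur hra).
rewrite (fam_mul_cone_seq cs cR ur hra) (fam_mul_cone_seq cs cR ur hr).
rewrite !mulr_suml -!big_split /=; apply: eq_bigr => nu _.
by rewrite -!mulrA -!mulrDr [mu - a - nu]addrAC h.
Qed.

(** * The series defined by the recursion, as a locally finite sum *)

Section Iteration.
Variables (F : lattice n -> T) (phi : lattice n -> T)
  (S : nat -> lattice n -> T).
Hypothesis cF : cone_supported F.
Hypothesis F0 : F 0 = 0.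
Hypothesis S0 : S 0 = fam_single 0 1.
Hypothesis S1 : forall m mu, S m.+1 mu =
  if mu == 0 then 0 else phi mu * fam_mul (S m) F mu.

Let cS m : cone_supported (S m).
Proof.
elim: m => [|m IH] mu nmu; first by rewrite S0 fam_single_supported // cone0.
by rewrite S1 fam_mul_supported // mulr0 if_same.
Qed.

(** As [F 0 = 0], each factor [F] raises the height by at least one, so only finitely many iterates
    contribute at a given [mu]. *)
Let S_height m mu : (height mu < m)%N -> S m mu = 0.
Proof.
elim: m mu => // m IH mu hm; rewrite S1; case: eqP => // _.
rewrite (fam_mul_seq (r := [::])) ?big_nil ?mulr0 // => nu _.
have [->|ne] := eqVneq nu mu; first by rewrite subrr F0 mulr0.
have [cnu|ncnu] := boolP (in_cone nu); last by rewrite cS // mul0r.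
have [cd|ncd] := boolP (in_cone (mu - nu)); last by rewrite cF // mulr0.
by rewrite IH ?mul0r // (leq_trans (height_lt cnu cd ne)).
Qed.

Let Stot mu := \sum_(m \in [set: nat]) S m mu.

Let StotE N mu : (height mu < N)%N -> Stot mu = \sum_(m < N) S m mu.
Proof.
move=> hN; rewrite /Stot (fsbigE (index_iota 0 N)) ?iota_uniq //.
  rewrite (eq_bigl predT) ?big_mkord // => m; exact/mem_set.
move=> m _; rewrite mem_index_iota /= -leqNgt => hm.
by apply: S_height; apply: leq_trans hm.
Qed.

Lemma iteration_supported : cone_supported Stot.
Proof.
by move=> mu nmu; rewrite (@StotE (height mu).+1) // big1 // => m _; apply: cS.
Qed.

Lemma iteration0 : Stot 0 = 1.
Proof.
rewrite (@StotE 1) ?big_ord1 ?S0 /fam_single ?eqxx //.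
by rewrite ltnS leqn0 height_eq0.
Qed.

Lemma iterationE mu : mu != 0 -> Stot mu = phi mu * fam_mul Stot F mu.
Proof.
move=> mu0; have [r ur hr] := cone_interval mu.
(* One term more than necessary: once [S 0] is split off, the recursion leaves the indices below
   [(height mu).+1], enough to form [Stot nu] for every [nu] in the interval. *)
rewrite (@StotE (height mu).+2) // big_ord_recl S0 /fam_single (negPf mu0) add0r.
rewrite (fam_mul_cone_seq iteration_supported cF ur hr).
under eq_bigr => m _ do
  rewrite S1 (negPf mu0) (fam_mul_cone_seq (@cS _) cF ur hr).
rewrite -mulr_sumr exchange_big /=; congr (_ * _); apply: eq_bigr => nu _.
rewrite -mulr_suml.
have [cnu|ncnu] := boolP (in_cone nu); last first.
  by rewrite iteration_supported // big1 // => m _; apply: cS.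
have [cd|ncd] := boolP (in_cone (mu - nu)); last by rewrite (cF ncd) !mulr0.
rewrite (@StotE (height mu).+1) // ltnS.
by rewrite -[mu](subrK nu) heightD // leq_addl.
Qed.

End Iteration.

End Families.

(** Only additivity of [g] is asked, so that besides algebra maps it may be left multiplication by 1
    (x) e_alpha or a conjugation whose rescaling depends on the weight. *)
Lemma fam_mul_map (n : nat) (T T' : pzRingType) (g : T -> T')
    (s t : lattice n -> T) (s' t' : lattice n -> T') mu :
  g 0 = 0 -> {morph g : x y / x + y} ->
  cone_supported s -> cone_supported t ->
  (forall nu, s' nu * t' (mu - nu) = g (s nu * t (mu - nu))) ->
  fam_mul s' t' mu = g (fam_mul s t mu).
Proof.
move=> g0 gD cs ct h; have [r ur hr] := cone_interval mu.
rewrite (fam_mul_cone_seq cs ct ur hr) (big_morph g gD g0) (fam_mul_seq (r := r)) //.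
  by apply: eq_bigr => nu _.
move=> nu; apply: contraNeq => ne; apply: hr; apply: contraNT ne => nc.
  by rewrite h cs // mul0r g0.
by rewrite h ct // mulr0 g0.
Qed.

(** * The torus *)

Section QPow.
Variables (R : realType) (hbar : complex R).
Local Notation C := (complex R).
Implicit Types z w : C.

Lemma cexpD z w : cexp (z + w) = cexp z * cexp w.
Proof.
case: z w => [a b] [c d]; rewrite /cexp /= expRD cosD sinD.
by apply/eqP; rewrite eq_complex /=; apply/andP; split; apply/eqP; ring.
Qed.

Lemma cexp0 : cexp (0 : C) = 1.
Proof. by rewrite /cexp /= expR0 cos0 sin0 mulr0 mulr1. Qed.

Lemma qpowD z w : qpow hbar (z + w) = qpow hbar z * qpow hbar w.
Proof. by rewrite /qpow mulrDr cexpD. Qed.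

Lemma qpow0 : qpow hbar 0 = 1.
Proof. by rewrite /qpow mulr0 cexp0. Qed.

Lemma qpowK z : qpow hbar (- z) * qpow hbar z = 1.
Proof. by rewrite -qpowD addNr qpow0. Qed.

Lemma qpow_neq0 z : qpow hbar z != 0.
Proof. by apply/eqP => h; have /eqP := qpowK z; rewrite h mulr0 eq_sym oner_eq0. Qed.

Lemma qpow_sub_neq0 :
  (forall m : nat, (0 < m)%N -> qpow hbar 1 ^+ m != 1) ->
  qpow hbar 1 - (qpow hbar 1)^-1 != 0.
Proof.
move=> /(_ 2%N isT); apply: contraNN; rewrite subr_eq0 => /eqP h.
by rewrite expr2 {1}h mulVf // qpow_neq0.
Qed.

End QPow.

(** [inverse_of] has the default value 0; the witness [b] guarantees that the chosen element is a
    genuine inverse. *)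
Lemma inverse_ofP (A : pzRingType) (x b : A) : b * x = 1 -> x * b = 1 ->
  x * inverse_of x = 1 /\ inverse_of x * x = 1.
Proof.
move=> b1 b2.
by apply: (@xgetPex _ 0 [set y | x * y = 1 /\ y * x = 1]%classic); exists b.
Qed.

Section Torus.
Variables (R : realType) (hbar : complex R) (n : nat).
Local Notation C := (complex R).
Local Notation qp := (qpow hbar).
Variables (A : algebra C).

(** Integer powers of [x] with [y] in the role of its inverse, in the very form of the factors of
    [qpowh]. *)
Definition kpow (x y : A) (m : int) : A :=
  if 0 <= m then x ^+ `|m| else y ^+ `|m|.

Lemma kpowS (x y : A) m : x * y = 1 -> kpow x y (m + 1) = x * kpow x y m.
Proof.
move=> xy; case: m => [m|[|m]]; rewrite /kpow.
- by rewrite -PoszD addn1 -exprS.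
- by rewrite /= expr1 xy.
- have -> : Negz m.+1 + 1 = Negz m by rewrite !NegzE -addn1 PoszD; lia.
  by rewrite /= [in RHS]exprS mulrA xy mul1r.
Qed.

Lemma kpowB (x y : A) m : x * y = 1 -> y * x = 1 -> kpow x y (m - 1) = y * kpow x y m.
Proof. by move=> xy yx; rewrite -{2}[m](subrK 1) kpowS // mulrA yx mul1r. Qed.

Lemma kpowD (x y : A) m k : x * y = 1 -> y * x = 1 ->
  kpow x y (m + k) = kpow x y m * kpow x y k.
Proof.
move=> xy yx; elim/int_ind: m => [|m IH|m IH]; first by rewrite add0r mul1r.
- by rewrite -addn1 PoszD addrAC !kpowS // IH mulrA.
- by rewrite -addn1 PoszD opprD addrAC !kpowB // IH mulrA.
Qed.

Lemma kpow_twist (x y z : A) c m : x * y = 1 -> y * x = 1 ->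
  x * z = qp c *: (z * x) -> kpow x y m * z = qp (c * m%:~R) *: (z * kpow x y m).
Proof.
move=> xy yx xz.
have yz : y * z = qp (- c) *: (z * y).
  rewrite -[y * z]mulr1 -xy mulrA -[y * z * x]mulrA.
  have -> : z * x = qp (- c) *: (x * z) by rewrite xz scalerA qpowK scale1r.
  by rewrite -ascalerAr mulrA yx mul1r ascalerAl.
elim/int_ind: m => [|m IH|m IH]; first by rewrite mulr0 qpow0 scale1r mulr1 mul1r.
- rewrite -addn1 PoszD kpowS // -mulrA IH -ascalerAr mulrA xz -ascalerAl scalerA.
  by rewrite -qpowD rmorphD mulrDr mulr1 mulrA.
- rewrite -addn1 PoszD opprD kpowB // -mulrA IH -ascalerAr mulrA yz -ascalerAl.
  by rewrite scalerA -qpowD rmorphB mulrBr mulr1 mulrA.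
Qed.

Lemma kpow_scale (x y : A) c m : x * y = 1 -> y * x = 1 ->
  kpow (qp c *: x) (qp (- c) *: y) m = qp (c * m%:~R) *: kpow x y m.
Proof.
move=> xy yx.
have xy' : (qp c *: x) * (qp (- c) *: y) = 1.
  by rewrite -ascalerAl -ascalerAr scalerA mulrC qpowK xy scale1r.
have yx' : (qp (- c) *: y) * (qp c *: x) = 1.
  by rewrite -ascalerAl -ascalerAr scalerA qpowK yx scale1r.
elim/int_ind: m => [|m IH|m IH]; first by rewrite mulr0 qpow0 scale1r.
- rewrite -addn1 PoszD !kpowS // IH -ascalerAl -ascalerAr scalerA -qpowD.
  by rewrite rmorphD mulrDr mulr1 addrC.
- rewrite -addn1 PoszD opprD !kpowB // IH -ascalerAl -ascalerAr scalerA -qpowD.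
  by rewrite rmorphB mulrBr mulr1 addrC.
Qed.

Variables K V : 'I_n -> A.
Hypothesis KV : forall j, K j * V j = 1.
Hypothesis VK : forall j, V j * K j = 1.
Hypothesis KK : forall j k, K j * K k = K k * K j.
Implicit Types mu nu : lattice n.
Local Notation kh := (qpowh hbar K V).

Lemma torus_VK j k : K k * V j = V j * K k.
Proof.
rewrite -[RHS]mulr1 -(KV j) mulrA -[V j * K k * K j]mulrA KK mulrA VK.
by rewrite mul1r.
Qed.

Lemma qpowhE mu c : kh mu c = qp c *: \prod_j kpow (K j) (V j) (mu 0 j).
Proof. by []. Qed.

Lemma qpowh_twist (z : A) (p : 'I_n -> C) mu c :
  (forall j, K j * z = qp (p j) *: (z * K j)) ->
  kh mu c * z = qp (\sum_j p j * (mu 0 j)%:~R) *: (z * kh mu c).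
Proof.
move=> Kz; rewrite qpowhE -ascalerAl -ascalerAr scalerA mulrC -scalerA.
congr (_ *: _).
elim/big_rec2: _ => [|j x y _ IH]; first by rewrite qpow0 scale1r mulr1 mul1r.
rewrite -mulrA IH -ascalerAr [_ * (z * y)]mulrA (kpow_twist _ (KV j) (VK j) (Kz j)).
by rewrite -ascalerAl scalerA addrC qpowD -mulrA.
Qed.

Lemma qpowh_comm (z : A) mu c : (forall j, K j * z = z * K j) -> kh mu c * z = z * kh mu c.
Proof.
move=> Kz; have h j : K j * z = qp 0 *: (z * K j).
  by rewrite qpow0 scale1r Kz.
by rewrite (qpowh_twist _ _ h) big1 ?qpow0 ?scale1r // => j _; rewrite mul0r.
Qed.

Let kpow_comm j (z : A) m : K j * z = z * K j ->
  kpow (K j) (V j) m * z = z * kpow (K j) (V j) m.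
Proof.
move=> Kz; have h : K j * z = qp 0 *: (z * K j) by rewrite qpow0 scale1r Kz.
by rewrite (kpow_twist _ (KV j) (VK j) h) mul0r qpow0 scale1r.
Qed.

Lemma qpowhD mu nu c d : kh mu c * kh nu d = kh (mu + nu) (c + d).
Proof.
rewrite !qpowhE -ascalerAl -ascalerAr scalerA -qpowD -prodrM_comm.
  by congr (_ *: _); apply: eq_bigr => j _; rewrite mxE kpowD.
move=> j k _ _; apply: kpow_comm; apply/esym.
by apply: kpow_comm; rewrite KK.
Qed.

Lemma qpowh0 : kh 0 0 = 1.
Proof. by rewrite qpowhE big1 ?qpow0 ?scale1r // => j _; rewrite mxE. Qed.

Lemma qpowh_shift mu c d : qp d *: kh mu c = kh mu (c + d).
Proof. by rewrite !qpowhE scalerA -qpowD addrC. Qed.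

Lemma qpowh_simple j : kh (simple j) 0 = K j.
Proof.
rewrite qpowhE qpow0 scale1r (eq_bigr (fun k => if k == j then K j else 1)).
  by rewrite -big_mkcond big_pred1_eq.
by move=> k _; rewrite mxE eqxx /=; case: eqP => [->|].
Qed.

Lemma qpowh_scale (p : 'I_n -> C) mu c :
  qpowh hbar (fun j => qp (p j) *: K j) (fun j => qp (- p j) *: V j) mu c
  = kh mu (c + \sum_j p j * (mu 0 j)%:~R).
Proof.
rewrite /qpowh qpowD -scalerA; congr (_ *: _).
rewrite -!/(kpow _ _ _); under eq_bigr => j _ do rewrite -/(kpow _ _ _) kpow_scale //.
elim/big_rec3: _ => [|j x y z _ ->]; first by rewrite qpow0 scale1r.
by rewrite qpowD -scalerA -ascalerAl -ascalerAr.
Qed.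

Local Notation q := (qp 1).
Hypothesis q_neq0 : q - q^-1 != 0.

Lemma qpowh_sub1 mu c :
  kh (mu + mu) (c + c) - 1 = (q - q^-1) *: (kh mu c * qbrack hbar K V mu c).
Proof.
rewrite /qbrack -ascalerAr scalerA mulfV // scale1r mulrBr !qpowhD !subrr.
by rewrite qpowh0.
Qed.

(** The factors q^z and [z]_q of q^(2z) - 1 cancel against phi(z) = q^(-z) / [z]_q. The scalar left
    over is the one by which [Fcal] is divided. *)
Lemma phi_inverse mu c (b : A) : b * qbrack hbar K V mu c = 1 ->
  qbrack hbar K V mu c * b = 1 ->
  (kh (mu + mu) (c + c) - 1) * phi hbar K V mu c = (q - q^-1) *: (1 : A).
Proof.
move=> b1 b2; rewrite qpowh_sub1 -ascalerAl; congr (_ *: _); rewrite /phi.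
have [h _] := inverse_ofP b1 b2.
have cmm : qbrack hbar K V mu c * kh (- mu) (- c)
    = kh (- mu) (- c) * qbrack hbar K V mu c.
  by rewrite /qbrack -[in LHS]ascalerAl -[in RHS]ascalerAr mulrBl mulrBr !qpowhD
    [mu - mu]addrC [c - c]addrC.
by rewrite mulrA -[kh mu c * _ * _]mulrA cmm mulrA qpowhD !subrr qpowh0 mul1r.
Qed.

Lemma qpowh_sub1_inverse mu c (b : A) : b * qbrack hbar K V mu c = 1 ->
  ((q - q^-1)^-1 *: (b * kh (- mu) (- c))) * (kh (mu + mu) (c + c) - 1) = 1.
Proof.
move=> b1; rewrite qpowh_sub1 -ascalerAl -ascalerAr scalerA mulVf // scale1r.
by rewrite mulrA -[b * _ * _]mulrA qpowhD !addNr qpowh0 mulr1.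
Qed.

End Torus.

Lemma qpowh_alghom (R : realType) (hbar : complex R) (n : nat)
    (A A' : algebra (complex R)) (f : A -> A') (K V : 'I_n -> A) mu c :
  is_alghom f ->
  f (qpowh hbar K V mu c) = qpowh hbar (fun j => f (K j)) (fun j => f (V j)) mu c.
Proof.
move=> hf; rewrite /qpowh (alghomZ hf) (alghom_prod hf); congr (_ *: _).
by apply: eq_bigr => j _; case: ifP; rewrite (alghomX hf).
Qed.

Lemma qbrack_alghom (R : realType) (hbar : complex R) (n : nat)
    (A A' : algebra (complex R)) (f : A -> A') (K V : 'I_n -> A) mu c :
  is_alghom f ->
  f (qbrack hbar K V mu c) = qbrack hbar (fun j => f (K j)) (fun j => f (V j)) mu c.
Proof.
move=> hf; rewrite /qbrack (alghomZ hf) (alghomD hf) (alghomN hf).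
by rewrite !(qpowh_alghom _ _ _ _ _ hf).
Qed.

(* all_algebra exports another constant named form. *)
Local Notation form := Defs.form.

(** * The invariant form and rho *)

Section Form.
Variables (n : nat) (B : 'M[rat]_n) (F : comUnitRingType).
Implicit Types x y z : 'rV[F]_n.

Lemma formDl x y z : form B (x + y) z = form B x z + form B y z.
Proof. by rewrite /form !mulmxDl mxE. Qed.

Lemma formDr x y z : form B x (y + z) = form B x y + form B x z.
Proof. by rewrite /form linearD /= mulmxDr mxE. Qed.

Lemma formZr c x y : form B x (c *: y) = c * form B x y.
Proof. by rewrite /form linearZ /= -scalemxAr mxE. Qed.

Lemma formZl c x y : form B (c *: x) y = c * form B x y.
Proof. by rewrite /form -!scalemxAl mxE. Qed.

Lemma form_sumr (I : Type) (r : seq I) (P : pred I) x (f : I -> 'rV[F]_n) :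
  form B x (\sum_(i <- r | P i) f i) = \sum_(i <- r | P i) form B x (f i).
Proof.
apply: (big_morph (form B x)); first exact: formDr.
by rewrite /form linear0 mulmx0 mxE.
Qed.

Lemma form_symm x y : B^T = B -> form B x y = form B y x.
Proof.
move=> sB; rewrite /form.
transitivity ((x *m map_mx ratr B *m y^T)^T 0 0); first by rewrite [RHS]mxE.
by rewrite !trmx_mul trmxK map_trmx sB mulmxA.
Qed.

Lemma coordsD (mu nu : lattice n) : coords F (mu + nu) = coords F mu + coords F nu.
Proof. by apply/rowP => j; rewrite !mxE rmorphD. Qed.

Lemma coordsZ (mu : lattice n) k : coords F (mu *~ k) = k%:~R *: coords F mu.
Proof. by apply/rowP => j; rewrite mxE -scaler_int !mxE /= intz rmorphM. Qed.

Lemma coordsN (mu : lattice n) : coords F (- mu) = - coords F mu.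
Proof. by apply/rowP => j; rewrite !mxE rmorphN. Qed.

End Form.

(** The root system axioms speak of rational values, the exponents of q of complex ones. *)
Lemma form_rat (n : nat) (B : 'M[rat]_n) (F : numFieldType) (mu nu : lattice n) :
  form B (coords F mu) (coords F nu) = ratr (form B (coords rat mu) (coords rat nu)).
Proof.
have eB : map_mx ratr B = map_mx ratr (map_mx ratr B : 'M[rat]_n) :> 'M[F]_n.
  by rewrite -map_mx_comp; apply: eq_map_mx => x; rewrite -(fmorph_eq_rat (ratr \o ratr)).
have ec (la : lattice n) : coords F la = map_mx ratr (coords rat la).
  by apply/rowP => j; rewrite !mxE ratr_int.
by rewrite /form eB !ec map_trmx -!map_mxM mxE.
Qed.

(** * Simple reflections and the product of rho with a simple root *)

Section HalfSum.
Variables (n : nat) (B : 'M[rat]_n) (Phi : seq (lattice n)).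
Hypothesis hPhi : root_datum B Phi.
Variable i : 'I_n.
Local Notation alpha := (simple i).
Local Notation bil mu nu := (form B (coords rat mu) (coords rat nu)).

Let alpha_norm : bil alpha alpha != 0.
Proof.
rewrite gt_eqF // (form_pos hPhi) //; apply/eqP => /matrixP /(_ 0 i).
by rewrite !mxE !eqxx.
Qed.

(** The axioms only assert that some integer exists; on roots the quotient is that integer and
    [numq] recovers it. *)
Let co (b : lattice n) : int := numq (2 * bil b alpha / bil alpha alpha).
Let refl (b : lattice n) := b - alpha *~ co b.

Let coE b : b \in Phi -> (co b)%:~R * bil alpha alpha = 2 * bil b alpha.
Proof.
move=> bP; have [k [e _]] := roots_reflection hPhi (roots_simple hPhi i) bP.
by rewrite /co e mulfK // numq_int.
Qed.

Let refl_Phi b : b \in Phi -> refl b \in Phi.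
Proof.
move=> bP; have [k [e]] := roots_reflection hPhi (roots_simple hPhi i) bP.
by rewrite /refl /co e mulfK // numq_int.
Qed.

Let refl_form b : b \in Phi -> bil (refl b) alpha = - bil b alpha.
Proof.
move=> bP; rewrite /refl coordsD coordsN coordsZ formDl -scaleN1r scalerA.
by rewrite formZl mulN1r mulNr coE //; ring.
Qed.

Let reflK b : b \in Phi -> refl (refl b) = b.
Proof.
move=> bP; have e : co (refl b) = - co b.
  apply: (@intr_inj rat); apply: (mulIf alpha_norm); rewrite coE ?refl_Phi //.
  by rewrite refl_form // rmorphN mulNr coE // mulrN.
by rewrite {1}/refl e mulrNz opprK subrK.
Qed.

Let pos := [seq b <- Phi | in_cone b && (b != alpha)].

(** The reflection changes only the coordinate at [i]. A positive root other than alpha has another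
    nonzero coordinate because the system is reduced; this one stays positive, and the coordinates
    of a root never have opposite signs. *)
Let refl_pos b : b \in pos -> refl b \in pos.
Proof.
rewrite !mem_filter => /andP[/andP[cb ba] bP]; rewrite refl_Phi // andbT.
have off j : j != i -> refl b 0 j = b 0 j.
  move=> ji; have h : (alpha *~ co b) 0 j = 0.
    by rewrite -scaler_int !mxE (negPf ji) andbF mulr0.
  by rewrite /refl !mxE h subr0.
have [j ji bj] : exists2 j, j != i & b 0 j != 0.
  apply: contrapT => h; have b0 j : j != i -> b 0 j = 0.
    by move=> ji; apply: contrapT => /eqP bj; apply: h; exists j.
  have /(roots_reduced hPhi (roots_simple hPhi i) bP)[ab|ab] :
      coords rat b = (b 0 i)%:~R *: coords rat alpha.
    apply/rowP => j; rewrite !mxE eqxx /=; case: eqVneq => [->|ji].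
      by rewrite mulr1.
    by rewrite b0 // mulr0.
  - by rewrite ab eqxx in ba.
  - by have := forallP cb i; rewrite ab !mxE !eqxx.
have bj0 : 0 < refl b 0 j by rewrite off // lt_neqAle eq_sym bj (forallP cb).
have /orP[c|/forallP /(_ j)] := roots_sign hPhi (refl_Phi bP); last first.
  by rewrite mxE oppr_ge0 leNgt bj0.
by rewrite c; apply/eqP => e; move: bj0; rewrite e mxE eqxx (negPf ji).
Qed.

Let pos_sum0 : \sum_(b <- pos) bil b alpha = 0.
Proof.
have posP b : b \in pos -> b \in Phi by rewrite mem_filter => /andP[].
have upos : uniq pos by rewrite filter_uniq // (roots_uniq hPhi).
have pm : perm_eq [seq refl b | b <- pos] pos.
  have um : uniq [seq refl b | b <- pos].
    by rewrite map_inj_in_uniq // => x y /posP xP /posP yP e; rewrite -(reflK xP) e reflK.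
  apply: uniq_perm => // b; apply/mapP/idP => [[c cp ->]|bp]; first exact: refl_pos.
  by exists (refl b); [exact: refl_pos|rewrite reflK // posP].
have : \sum_(b <- pos) bil b alpha = - \sum_(b <- pos) bil b alpha.
  rewrite -{1}(perm_big _ pm) /= big_map -sumrN big_seq [RHS]big_seq.
  by apply: eq_bigr => b /posP bP; rewrite refl_form.
by lra.
Qed.

(* The reflection in alpha permutes the positive roots other than alpha and
   negates their products with alpha, so only alpha contributes to the sum. *)
Lemma form_rho (R : realType) :
  form B (coords (complex R) alpha) (rho R Phi) = pairing R B alpha alpha / 2.
Proof.
rewrite /rho formZr form_sumr mulrC; congr (_ / 2); rewrite /pairing.
transitivity (\sum_(b <- Phi | in_cone b) (ratr (bil b alpha) : complex R)).
  by apply: eq_bigr => b _; rewrite form_symm ?(form_sym hPhi) // form_rat.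
rewrite -rmorph_sum form_rat; congr (ratr _).
rewrite -big_filter (bigD1_seq alpha) /=.
- rewrite -big_filter -filter_predI -[RHS]addr0; congr (_ + _).
  by rewrite -[RHS]pos_sum0; congr bigop; apply: eq_filter => b /=; rewrite andbC.
- by rewrite mem_filter cone_simple (roots_simple hPhi).
- by rewrite filter_uniq // (roots_uniq hPhi).
Qed.

End HalfSum.

Section Pairing.
Variables (R : realType) (n : nat) (B : 'M[rat]_n).
Implicit Types mu nu la : lattice n.

Lemma pairingDl mu nu la : pairing R B (mu + nu) la = pairing R B mu la + pairing R B nu la.
Proof. by rewrite /pairing coordsD formDl. Qed.

Lemma pairingDr mu nu la : pairing R B la (mu + nu) = pairing R B la mu + pairing R B la nu.
Proof. by rewrite /pairing coordsD formDr. Qed.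

Lemma pairingNl mu la : pairing R B (- mu) la = - pairing R B mu la.
Proof. by rewrite /pairing coordsN -scaleN1r formZl mulN1r. Qed.

Lemma pairingNr mu la : pairing R B la (- mu) = - pairing R B la mu.
Proof. by rewrite /pairing coordsN -scaleN1r formZr mulN1r. Qed.

Lemma pairing0r la : pairing R B la 0 = 0.
Proof. by apply: (addrI (pairing R B la 0)); rewrite -pairingDr !addr0. Qed.

Lemma pairing_sym mu nu : B^T = B -> pairing R B mu nu = pairing R B nu mu.
Proof. exact: form_symm. Qed.

(** Identifies the exponent that accumulates when a product of powers of the K_j is commuted or
    rescaled factor by factor. *)
Lemma pairing_sum mu nu : B^T = B ->
  pairing R B nu mu = \sum_j pairing R B (simple j) nu * (mu 0 j)%:~R.
Proof.
move=> sB; rewrite /pairing.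
have {1}-> : coords (complex R) mu = \sum_j (mu 0 j)%:~R *: coords (complex R) (simple j).
  rewrite [LHS]row_sum_delta; apply: eq_bigr => j _; rewrite mxE; congr (_ *: _).
  by apply/rowP => k; rewrite !mxE; case: (_ && _).
rewrite form_sumr; apply: eq_bigr => j _.
by rewrite formZr form_symm // mulrC.
Qed.

(** The term (alpha, alpha) / 2 from the quadratic part cancels (alpha, rho), so that z_(mu - alpha)
    = z_mu - h_alpha - (mu, alpha). *)
Lemma etat_sub Phi mu i : root_datum B Phi ->
  etat R B Phi (mu - simple i) = etat R B Phi mu - pairing R B mu (simple i).
Proof.
move=> hPhi; have sB := form_sym hPhi.
rewrite /etat coordsD coordsN formDl -scaleN1r formZl (form_rho hPhi).
rewrite pairingDl !pairingDr !pairingNl !pairingNr (pairing_sym (simple i) mu sB).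
set x := pairing R B mu mu; set y := pairing R B mu _; set z := pairing R B _ _.
by rewrite [y in RHS]splitr; ring.
Qed.

Lemma etat0 Phi : etat R B Phi 0 = 0.
Proof.
rewrite /etat pairing0r mul0r addr0 /coords map_mx0 /form !mul0mx mxE.
by [].
Qed.

End Pairing.

(** * The quantum group *)

Section Relations.
Variables (R : realType) (n : nat) (B : 'M[rat]_n) (hbar : complex R).
Variable X : set (complex R).
Local Notation C := (complex R).
Local Notation U := (U B hbar).
Local Notation UK := (@UK R n B hbar).
Local Notation UV := (@UV R n B hbar).
Local Notation Ue := (@Ue R n B hbar).
Local Notation Uf := (@Uf R n B hbar).
Local Notation Uhat := (Uhat B hbar X).
Local Notation Bhat := (Bhat B hbar X).
Local Notation HK := (HK B hbar X).
Local Notation HV := (HV B hbar X).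
Local Notation BK := (BK B hbar X).
Local Notation BV := (BV B hbar X).
Local Notation Ucan := (@Ucan R n B hbar X).
Implicit Types mu nu : lattice n.

Lemma U_KV j : UK j * UV j = 1.
Proof.
apply: presP => A g hg; have hl := pres_lift_alghom hg.
rewrite (alghomM hl) (alghom1 hl) !(pres_lift_gen _ hg); exact: (rel_KV hg).
Qed.

Lemma U_VK j : UV j * UK j = 1.
Proof.
apply: presP => A g hg; have hl := pres_lift_alghom hg.
rewrite (alghomM hl) (alghom1 hl) !(pres_lift_gen _ hg); exact: (rel_VK hg).
Qed.

Lemma U_Ke j k :
  UK j * Ue k = qpow hbar (pairing R B (simple j) (simple k)) *: (Ue k * UK j).
Proof.
apply: presP => A g hg; have hl := pres_lift_alghom hg.
rewrite (alghomZ hl) !(alghomM hl) !(pres_lift_gen _ hg); exact: (rel_Ke hg).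
Qed.

Lemma weight_e k : weight (simple k) (Ue k).
Proof.
by move=> j; rewrite U_Ke -ascalerAl -mulrA U_KV mulr1.
Qed.

Lemma weight_1 : weight 0 (1 : U).
Proof. by move=> j; rewrite mulr1 U_KV pairing0r qpow0 scale1r. Qed.

Lemma is_decomposition_comult_e k (y : U) :
  is_decomposition (Ue k \ox y + 1 \ox Ue k)
    (fun mu => fam_single (simple k) (Ue k \ox y) mu
               + fam_single 0 (1 \ox Ue k) mu).
Proof.
have k0 := simple_neq0 k.
split.
- apply: (@sub_finite_set _ _ [set` [:: simple k; 0]]%classic); last exact: finite_seq.
  move=> nu /=; rewrite !inE /fam_single; apply: contraNT.
  by rewrite negb_or => /andP[/negPf-> /negPf->]; rewrite addr0.
- move=> nu; rewrite /fam_single; case: (eqVneq nu (simple k)) => [->|_].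
    rewrite (negPf k0) addr0; exists [:: (Ue k, y)]; rewrite big_seq1; split=> // p.
    by rewrite inE => /eqP->; split=> //; exact: weight_e.
  rewrite add0r; case: eqVneq => [->|_]; last first.
    by exists [::]; rewrite big_nil.
  exists [:: (1, Ue k)]; rewrite big_seq1; split=> // p.
  by rewrite inE => /eqP->; split=> //; exact: weight_1.
- rewrite (fsbigE [:: simple k; 0]) /=.
  + rewrite (eq_bigl predT) => [|nu]; last exact/mem_set.
    rewrite big_cons big_seq1.
    by rewrite /fam_single !eqxx (negPf k0) eq_sym (negPf k0) addr0 add0r.
  + by rewrite inE k0.
  + by [].
  + move=> nu _; rewrite !inE negb_or /fam_single => /andP[/negPf-> /negPf->].
    by rewrite addr0.
Qed.

Lemma qbrack_invertible mu c : in_cone mu -> mu != 0 -> X (- c) ->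
  exists2 b : Bhat, b * qbrack hbar BK BV mu c = 1
    & qbrack hbar BK BV mu c * b = 1.
Proof.
(* The localization inverts [h_mu - c']_q, hence the index c' = -c for [h_mu + c]_q. *)
move=> cmu mu0 Xc; pose p : loc_index n X := exist _ (mu, - c) (And3 cmu mu0 Xc).
have sh : is_alghom (@sincl _ Uhat (Bhat_gens (X := X))) by split.
have [h1 h2] : qbrack hbar HK HV mu c * Hinv B hbar p = 1 /\
    Hinv B hbar p * qbrack hbar HK HV mu c = 1.
  have lq (A : algebra C) (g : Ugen n + loc_index n X -> A) (hg : Uhat_rel B hbar g) :
      pres_lift g (qbrack hbar HK HV mu c)
      = qbrack hbar (g \o inl \o @GK n) (g \o inl \o @GV n) mu c.
    rewrite (qbrack_alghom hbar HK HV mu c (pres_lift_alghom hg)).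
    have -> : (fun j => pres_lift g (HK j)) = g \o inl \o @GK n.
      by apply/funext => j; exact: pres_lift_gen.
    have -> // : (fun j => pres_lift g (HV j)) = g \o inl \o @GV n.
    by apply/funext => j; exact: pres_lift_gen.
  split; apply: presP => A g hg; have hl := pres_lift_alghom hg;
    have [_ /(_ p)[/=]] := hg; rewrite opprK => g1 g2;
    rewrite (alghomM hl) (alghom1 hl) (lq _ _ hg) (pres_lift_gen _ hg) //.
have gp : Bhat_gens (Hinv B hbar p) by right; exists p.
have sq : sincl (qbrack hbar BK BV mu c) = qbrack hbar HK HV mu c.
  exact: (qbrack_alghom hbar BK BV mu c sh).
have sM := alghomM sh.
exists (sgen gp); apply: val_inj; rewrite -[val _]/(sincl _) sM sq.
  exact: h2.
exact: h1.
Qed.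
Lemma H_KV j : HK j * HV j = 1. Proof. exact: rel_KV (Uhat_Uq_rel B hbar X) j. Qed.
Lemma H_VK j : HV j * HK j = 1. Proof. exact: rel_VK (Uhat_Uq_rel B hbar X) j. Qed.
Lemma H_KK j k : HK j * HK k = HK k * HK j.
Proof. exact: rel_KK (Uhat_Uq_rel B hbar X) j k. Qed.
Lemma B_KV j : BK j * BV j = 1. Proof. apply: val_inj; exact: H_KV. Qed.
Lemma B_VK j : BV j * BK j = 1. Proof. apply: val_inj; exact: H_VK. Qed.
Lemma B_KK j k : BK j * BK k = BK k * BK j.
Proof. apply: val_inj; exact: H_KK. Qed.

Definition sinclB : {linear Bhat -> Uhat} := @sincl C Uhat (Bhat_gens (X := X)).

Lemma sinclB_alghom : is_alghom sinclB.
Proof. by split=> //; apply: linearP. Qed.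

Definition toH : {linear tens (Uplus B hbar) Bhat -> tens (Uplus B hbar) Uhat} :=
  tens_map idfun sinclB.

Lemma toHM : {morph toH : x y / x * y}.
Proof. by apply: tens_mapM. Qed.

(** * The quasi-R-matrix over the localized algebras *)

Section Rcheck.
Variables (Delta Deltat : U -> tensA U U).
Hypothesis hDelta : is_comult UK UV Delta.
Hypothesis hDeltat : is_comult UV UK Deltat.
Variable Rc : lattice n -> tens (Uplus B hbar) (Uminus B hbar).
Hypothesis hRc : is_Rcheck Delta Deltat Rc.

Definition RB mu : tens (Uplus B hbar) Bhat :=
  tens_map idfun (@Uminus_Bhat R n B hbar X) (Rc mu).

Lemma RB_supported : cone_supported RB.
Proof. by move=> mu nmu; rewrite /RB (Rcheck_out hRc nmu) linear0. Qed.

Lemma RB0 : RB 0 = 1.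
Proof.
rewrite /RB (Rcheck0 hRc) tens_map_pure /=; congr (_ \ox _); apply: val_inj.
exact: alghom1 (Ucan_alghom B hbar X).
Qed.

(** The second legs of R_mu have weight -mu, and K_j commutes with them up to the corresponding
    power of q. *)
Lemma RB_weight mu j :
  RB mu * (1 \ox BK j)
  = qpow hbar (pairing R B (simple j) mu) *: ((1 \ox BK j) * RB mu).
Proof.
have [cmu|ncmu] := boolP (in_cone mu); last first.
  by rewrite RB_supported // mul0r mulr0 scaler0.
have [s [sw e]] := Rcheck_weight hRc cmu; rewrite /RB e raddf_sum.
rewrite mulr_suml mulr_sumr scaler_sumr big_seq [RHS]big_seq.
apply: eq_bigr => p ps; have [_ w] := sw p ps.
rewrite /= tens_map_pure !tpureM mulr1 mul1r -tpureZr; congr (_ \ox _).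
apply: val_inj; rewrite [LHS](alghomM sinclB_alghom) [RHS](alghomZ sinclB_alghom).
rewrite (alghomM sinclB_alghom) -[sinclB (Uminus_Bhat _ _)]/(Ucan (sincl p.2)).
have := congr1 (fun x => Ucan (x * UK j)) (w j) => /=.
rewrite pairingNr -!mulrA U_VK mulr1 -ascalerAl.
rewrite (alghomZ (Ucan_alghom B hbar X)) !(alghomM (Ucan_alghom B hbar X)).
have -> : Ucan (UK j) = HK j by exact: pres_lift_gen (Uhat_Uq_rel B hbar X).
by move=> ->; rewrite scalerA mulrC qpowK scale1r.
Qed.

Definition RH mu := toH (RB mu).

(* The hypothesis on Rc is an identity in U (x) U; it is pulled back along the
   injection U^+ (x) U -> U (x) U before mapping to U^+ (x) \hat U. *)
Lemma RH_intertwines i mu :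
  (Pe B hbar i \ox HV i) * RH (mu - simple i) + (1 \ox He B hbar X i) * RH mu
  = RH (mu - simple i) * (Pe B hbar i \ox HK i) + RH mu * (1 \ox He B hbar X i).
Proof.
pose ip : {linear Uplus B hbar -> U} := @sincl _ U (range Ue).
pose im : {linear Uminus B hbar -> U} := @sincl _ U (range Uf).
(* [RU] is the common source: [tU] sends it to the family in the hypothesis on [Rc], and [tH] sends
   it to [RH]. *)
pose RU nu := tens_map (idfun : {linear Uplus B hbar -> Uplus B hbar}) im (Rc nu).
pose tU := tens_map ip (idfun : {linear U -> U}).
pose tH := tens_map (idfun : {linear Uplus B hbar -> Uplus B hbar}) Ucan.
have tUM : {morph tU : x y / x * y} by apply: tens_mapM.
have tHM : {morph tH : x y / x * y}.
  by apply: tens_mapM => //; apply: alghomM (Ucan_alghom B hbar X).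
have tUD : {morph tU : x y / x + y} by move=> x y; rewrite /tU raddfD.
have tHD : {morph tH : x y / x + y} by move=> x y; rewrite /tH raddfD.
have ipi : injective ip by move=> x y; apply: val_inj.
have RUE nu : tU (RU nu) = Rcheck_UU Rc nu by apply: tens_map_comp.
have RHE nu : tH (RU nu) = RH nu.
  pose pH : {linear Uminus B hbar -> Uhat} := Ucan \o im.
  transitivity (tens_map (idfun : {linear Uplus B hbar -> Uplus B hbar}) pH (Rc nu)).
    by apply: tens_map_comp.
  by apply: esym; apply: tens_map_comp.
have gens : [/\ Ucan (UK i) = HK i, Ucan (UV i) = HV i & Ucan (Ue i) = He B hbar X i].
  by split; exact: pres_lift_gen (Uhat_Uq_rel B hbar X).
have key : (Pe B hbar i \ox UV i) * RU (mu - simple i) + (1 \ox Ue i) * RU mu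
    = RU (mu - simple i) * (Pe B hbar i \ox UK i) + RU mu * (1 \ox Ue i).
  apply: (tens_map_inj ipi); rewrite -[LHS]/(tU _) -[RHS]/(tU _).
  rewrite !tUD !tUM !RUE /tU !tens_map_pure /=.
  have [_ _ De _ _] := hDelta; have [_ _ Dte _ _] := hDeltat.
  have d := is_decomposition_comult_e i (UK i); rewrite -De in d.
  have dt := is_decomposition_comult_e i (UV i); rewrite -Dte in dt.
  have := congr1 (fun f => f mu) (Rcheck_intertwines hRc d dt).
  by rewrite /= fam_mul_two_l ?fam_mul_two_r ?simple_neq0 // => ->.
have := congr1 tH key; rewrite !tHD !tHM !RHE /tH !tens_map_pure /=.
by have [-> -> ->] := gens.
Qed.

End Rcheck.

End Relations.

(** * The fusion element *)

Section Main.
Variables (R : realType) (n : nat) (B : 'M[rat]_n) (Phi : seq (lattice n)).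
Hypothesis hPhi : root_datum B Phi.
Variable hbar : complex R.
Hypothesis hq : forall m : nat, (0 < m)%N -> qpow hbar 1 ^+ m != 1.
Variable X : set (complex R).
Hypothesis hX : admissible B X Phi.
Local Notation C := (complex R).
Local Notation U := (U B hbar).
Local Notation Uplus := (Uplus B hbar).
Local Notation Uhat := (Uhat B hbar X).
Local Notation Bhat := (Bhat B hbar X).
Local Notation HK := (HK B hbar X).
Local Notation HV := (HV B hbar X).
Local Notation BK := (BK B hbar X).
Local Notation BV := (BV B hbar X).
Local Notation q := (qpow hbar 1).
Local Notation etat := (etat R B Phi).
Local Notation pair := (pairing R B).
Implicit Types mu nu : lattice n.

Variables (Delta Deltat : U -> tensA U U).
Hypothesis hDelta : is_comult (@UK R n B hbar) (@UV R n B hbar) Delta.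
Hypothesis hDeltat : is_comult (@UV R n B hbar) (@UK R n B hbar) Deltat.
Variable Rc : lattice n -> tens Uplus (Uminus B hbar).
Hypothesis hRc : is_Rcheck Delta Deltat Rc.
Local Notation RB := (RB X Rc).
Local Notation RH := (RH X Rc).
Local Notation S := (Stilde X Phi Rc).

Let q_neq0 : q - q^-1 != 0. Proof. exact: qpow_sub_neq0. Qed.
Let sB : B^T = B. Proof. exact: form_sym hPhi. Qed.
Let cRB : cone_supported RB. Proof. exact: RB_supported hRc. Qed.

Let FcalE mu : Fcal X Rc mu = (q - q^-1)^-1 *: (RB mu - fam_single 0 1 mu).
Proof.
rewrite /Fcal linearB; congr (_ *: (_ - _)); rewrite /fam_single.
case: eqP => _; last by rewrite linear0.
rewrite /= tens_map_pure; congr (_ \ox _); apply: val_inj.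
exact: alghom1 (Ucan_alghom B hbar X).
Qed.

Let cF : cone_supported (Fcal X Rc).
Proof.
move=> mu nmu; rewrite FcalE cRB // fam_single_supported ?cone0 //.
by rewrite subr0 scaler0.
Qed.

Let F0 : Fcal X Rc 0 = 0.
Proof. by rewrite FcalE (RB0 X hRc) /fam_single eqxx subrr scaler0. Qed.

Lemma Stilde_supported : cone_supported S.
Proof.
exact: (@iteration_supported _ _ (Fcal X Rc) (fun mu => 1 \ox phi hbar BK BV mu (etat mu))
  (Stilde_n X Phi Rc) cF F0).
Qed.

Lemma Stilde0 : S 0 = 1.
Proof.
exact: (@iteration0 _ _ (Fcal X Rc) (fun mu => 1 \ox phi hbar BK BV mu (etat mu))
  (Stilde_n X Phi Rc) cF F0).
Qed.

Let SE mu : mu != 0 ->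
  S mu = (1 \ox phi hbar BK BV mu (etat mu)) * fam_mul S (Fcal X Rc) mu.
Proof.
exact: (@iterationE _ _ (Fcal X Rc) (fun mu => 1 \ox phi hbar BK BV mu (etat mu))
  (Stilde_n X Phi Rc) cF F0).
Qed.

Lemma Stilde_ABRR mu :
  (1 \ox qpowh hbar BK BV (mu + mu) (etat mu + etat mu)) * S mu = fam_mul S RB mu.
Proof.
have cS := Stilde_supported.
have [->|mu0] := eqVneq mu 0.
  rewrite fam_mul0 // (RB0 X hRc) (etat0 R B) !addr0 (qpowh0 hbar) mulr1.
  exact: mul1r.
have [cmu|ncmu] := boolP (in_cone mu); last first.
  by rewrite cS // fam_mul_supported // mulr0.
have [b b1 b2] := @qbrack_invertible R n B hbar X _ _ cmu mu0 (hX.1 mu cmu mu0).2.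
(* Subtracting 1 (x) 1 from R removes exactly the diagonal term [S mu] of the product. *)
have SF : (q - q^-1) *: fam_mul S (Fcal X Rc) mu = fam_mul S RB mu - S mu.
  rewrite -[S mu in RHS]mulr1 -fam_mul_single0r.
  have [r ur hr] := cone_interval mu.
  have c1 := @fam_single_supported n (tens Uplus Bhat) 0 1 (cone0 n).
  rewrite !(fam_mul_cone_seq _ _ ur hr) //.
  rewrite scaler_sumr -sumrB; apply: eq_bigr => nu _.
  by rewrite FcalE tscalerAr scalerA mulfV // scale1r mulrBr.
have := phi_inverse (B_KV B hbar X) (B_VK B hbar X) (B_KK B hbar X) q_neq0 b1 b2.
set th := qpowh _ _ _ _ _ => thE.
have : (1 \ox (th - 1)) * S mu = fam_mul S RB mu - S mu.
  by rewrite {1}SE // mulrA tpureM mul1r thE tpureZr -tscalerAl tpure11 mul1r SF.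
by rewrite tpureDr tpureNr mulrDl mulNr tpure11 mul1r => /addIr.
Qed.

(* The solution of the ABRR equation is unique, and unchanged by a rescaled
   conjugation with K_j because the coefficients commute with K_j and RB is
   homogeneous. *)
Lemma Stilde_weight mu j :
  S mu * (1 \ox BK j)
  = qpow hbar (pair (simple j) mu) *: ((1 \ox BK j) * S mu).
Proof.
have cS := Stilde_supported.
pose Z nu := qpow hbar (- pair (simple j) nu) *: ((1 \ox BV j) * S nu * (1 \ox BK j)).
have ZS : Z = S.
  (* The left inverse of q^(2z) - 1 is read off from its factorization (q - q^-1) q^z [z]_q. *)
  apply: (fam_mul_unique (R := RB) (theta' := fun nu => 1 \ox ((q - q^-1)^-1 *:
     (inverse_of (qbrack hbar BK BV nu (etat nu)) * qpowh hbar BK BV (- nu) (- etat nu))))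
     (theta := fun nu => 1 \ox qpowh hbar BK BV (nu + nu) (etat nu + etat nu))) => //.
  - by move=> nu /cS; rewrite /Z => ->; rewrite mulr0 mul0r scaler0.
  - exact: RB0 hRc.
  - move=> nu cnu nu0; rewrite -tpure11 -tpureNr -tpureDr tpureM mul1r.
    have [b b1 b2] := @qbrack_invertible R n B hbar X _ _ cnu nu0 (hX.1 nu cnu nu0).2.
    rewrite (qpowh_sub1_inverse (B_KV B hbar X) (B_VK B hbar X) (B_KK B hbar X) q_neq0) //.
    exact: (inverse_ofP b1 b2).2.
  - move=> nu _.
    pose g (x : tens Uplus Bhat) :=
      qpow hbar (- pair (simple j) nu) *: ((1 \ox BV j) * x * (1 \ox BK j)).
    rewrite (@fam_mul_map _ _ _ g S RB Z RB) //.
    + rewrite -Stilde_ABRR /g /Z -tscalerAr; congr (_ *: _); rewrite !mulrA !tpureM.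
      rewrite mulr1 (qpowh_comm hbar (B_KV B hbar X) (B_VK B hbar X)) // => k.
      exact: torus_VK (B_KV B hbar X) (B_VK B hbar X) (B_KK B hbar X) j k.
    + by rewrite /g mulr0 mul0r scaler0.
    + by move=> x y; rewrite /g mulrDr mulrDl scalerDr.
    (* Moving K_j across R_(nu - ka) produces q^(alpha_j, nu - ka), the ratio of the two
       rescalings. *)
    + move=> ka; rewrite /Z /g -tscalerAl -!mulrA.
      rewrite (RB_weight X hRc) -!tscalerAr [RHS]scalerA.
      congr (_ *: _); rewrite -qpowD; congr (qpow _ _).
      by rewrite pairingDr pairingNr; ring.
  - move=> nu _; exact: Stilde_ABRR.
  - rewrite /Z Stilde0 pairing0r oppr0 qpow0 scale1r mulr1 tpureM mulr1.
    by rewrite B_VK.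
have := congr1 (fun f => (1 \ox BK j) * f mu) ZS; rewrite /= /Z -tscalerAr.
rewrite !mulrA tpureM mulr1 B_KV tpure11 mul1r => <-.
by rewrite scalerA mulrC qpowK scale1r.
Qed.

(** * The shift by alpha and the two solutions of the shifted equation *)

Section Shift.
Variable i : 'I_n.
Local Notation alpha := (simple i).
Variables tau tauV : {linear Bhat -> Bhat}.
Hypothesis htau : is_shift (coords C alpha) tau.
Hypothesis htauK : cancel tau tauV.
Hypothesis htauVK : cancel tauV tau.

Let tau_alghom : is_alghom tau. Proof. by case: htau. Qed.

Let tauV_alghom : is_alghom tauV.
Proof.
split=> [||x y]; first exact: linearP.
  by rewrite -[RHS]htauK (alghom1 tau_alghom).
by rewrite -[RHS]htauK (alghomM tau_alghom) !htauVK.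
Qed.

(** The induction follows the membership of [u] in U^-, so [b] enters only through its image in
    U-hat, which determines it. *)
Let tau_fix u : generated (range (@Uf R n B hbar)) u ->
  forall b : Bhat, sinclB B hbar X b = Ucan X u -> tau b = b.
Proof.
have hc := Ucan_alghom B hbar X; have hs := sinclB_alghom B hbar X.
elim => {u} [_ [k _ <-] b|b|a x y gx IHx gy IHy b|x y gx IHx gy IHy b] e.
- have -> : b = Bf B hbar X k.
    apply: val_inj; apply: etrans e _; exact: pres_lift_gen (Uhat_Uq_rel B hbar X).
  by have [_ _ tf _ _] := htau.
- have -> : b = 1 by apply: val_inj; apply: etrans e _; exact: alghom1 hc.
  exact: alghom1 tau_alghom.
- pose bx : Bhat := SubAlg (Ucan_Uminus X (introT (gen_predP _ _) gx)).
  pose b' : Bhat := SubAlg (Ucan_Uminus X (introT (gen_predP _ _) gy)).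
  have -> : b = a *: bx + b'.
    by apply: val_inj; apply: etrans e _; rewrite (alghomP hc).
  by rewrite (alghomP tau_alghom) IHx // IHy.
- pose bx : Bhat := SubAlg (Ucan_Uminus X (introT (gen_predP _ _) gx)).
  pose b' : Bhat := SubAlg (Ucan_Uminus X (introT (gen_predP _ _) gy)).
  have -> : b = bx * b'.
    by apply: val_inj; apply: etrans e _; rewrite (alghomM hc).
  by rewrite (alghomM tau_alghom) IHx // IHy.
Qed.

Let tauV_fix (x : Uminus B hbar) : tauV (Uminus_Bhat X x) = Uminus_Bhat X x.
Proof.
rewrite -{1}(@tau_fix (sincl x) _ (Uminus_Bhat X x)) //.
exact: (elimT (gen_predP _ _) (valP (x : subalg_type _))).
Qed.

Let p j := - pair (simple j) alpha.

Let tauV_K j : tauV (BK j) = qpow hbar (p j) *: BK j.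
Proof.
apply: (can_inj htauK); rewrite htauVK (alghomZ tau_alghom).
have [_ _ _ -> _] := htau.
by rewrite scalerA /p (pairing_sym R _ _ sB) /pairing qpowK scale1r.
Qed.

Let tauV_V j : tauV (BV j) = qpow hbar (- p j) *: BV j.
Proof.
apply: (can_inj htauK); rewrite htauVK (alghomZ tau_alghom).
have [_ _ _ _ ->] := htau.
by rewrite scalerA /p (pairing_sym R _ _ sB) /pairing -qpowD opprK addrN qpow0 scale1r.
Qed.

Let T : {linear tens Uplus Bhat -> tens Uplus Bhat} := tens_map idfun tauV.

Let TM : {morph T : x y / x * y}.
Proof. by apply: tens_mapM => // x y; rewrite (alghomM tauV_alghom). Qed.

Let S' mu := T (S mu).

Let TRB mu : T (RB mu) = RB mu.
Proof.
by rewrite /T /RB; apply: tens_map_comp.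
Qed.

(** On the torus tau_alpha^-1 replaces h_mu by h_mu - (alpha, mu); this is the origin of the shift
    in the equation for tau_alpha^-1(S). *)
Let T_qpowh mu c :
  T (1 \ox qpowh hbar BK BV mu c) = 1 \ox qpowh hbar BK BV mu (c - pair alpha mu).
Proof.
rewrite /T /= tens_map_pure /= (qpowh_alghom hbar BK BV mu c tauV_alghom).
rewrite (funext tauV_K) (funext tauV_V).
rewrite (qpowh_scale hbar (B_KV B hbar X) (B_VK B hbar X)) (pairing_sum R mu alpha sB).
congr (_ \ox qpowh _ _ _ _ (_ + _)); rewrite -sumrN.
by apply: eq_bigr => j _; rewrite mulNr.
Qed.

Let cS := Stilde_supported.

Let S'_supported : cone_supported S'.
Proof. by move=> mu /cS; rewrite /S' => ->; rewrite raddf0. Qed.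

Let S'0 : S' 0 = 1.
Proof. by rewrite /S' Stilde0 /T -tpure11 /= tens_map_pure /= (alghom1 tauV_alghom). Qed.

Let S'_ABRR mu :
  (1 \ox qpowh hbar BK BV (mu + mu) (etat mu + etat mu - pair alpha (mu + mu)))
    * S' mu = fam_mul S' RB mu.
Proof.
rewrite (@fam_mul_map _ _ _ T S RB S' RB) ?raddf0 //.
- by rewrite -Stilde_ABRR TM T_qpowh.
- by move=> x y; rewrite raddfD.
- by move=> nu; rewrite TM TRB.
Qed.

Let S'_weight mu :
  S' mu * (1 \ox BK i) = qpow hbar (pair alpha mu) *: ((1 \ox BK i) * S' mu).
Proof.
have TZ c x : T (c *: x) = c *: T x by exact: linearZ.
have := congr1 T (Stilde_weight mu i); rewrite TM TZ TM.
have -> : T (1 \ox BK i) = qpow hbar (p i) *: (1 \ox BK i).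
  by rewrite /T /= tens_map_pure tauV_K tpureZr.
(* Both sides acquire the same nonzero scalar from tau_alpha^-1(K_alpha), which is then
   cancelled. *)
rewrite -tscalerAr -tscalerAl scalerA mulrC -scalerA.
by move=> /(scalerI (qpow_neq0 _ _)).
Qed.

Local Notation toH := (toH B hbar X).
Local Notation G := (1 \ox He B hbar X i : tens Uplus Uhat).
Local Notation E := (Pe B hbar i \ox HV i : tens Uplus Uhat).
Local Notation theta mu c := (1 \ox qpowh hbar HK HV (mu + mu) (c + c) : tens Uplus Uhat).

Let toH_qpowh mu c : toH (1 \ox qpowh hbar BK BV mu c) = 1 \ox qpowh hbar HK HV mu c.
Proof.
have e := qpowh_alghom hbar BK BV mu c (sinclB_alghom B hbar X).
by rewrite /toH /= tens_map_pure e.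
Qed.

Let toH1 : toH 1 = 1.
Proof. by rewrite /toH -!tpure11 /= tens_map_pure. Qed.

Let toHM := @toHM R n B hbar X.

Let RH_supported : cone_supported RH.
Proof. by move=> mu nmu; rewrite /RH cRB // raddf0. Qed.

Let SH mu := toH (S mu).
Let SH' mu := toH (S' mu).

Let SH_supported : cone_supported SH.
Proof. by move=> mu /cS; rewrite /SH => ->; rewrite raddf0. Qed.

Let SH'_supported : cone_supported SH'.
Proof. by move=> mu /S'_supported; rewrite /SH' => ->; rewrite raddf0. Qed.

Let SH_ABRR mu : theta mu (etat mu) * SH mu = fam_mul SH RH mu.
Proof.
rewrite (@fam_mul_map _ _ _ toH S RB SH RH) ?raddf0 //.
- by rewrite -Stilde_ABRR toHM toH_qpowh.
- by move=> x y; rewrite raddfD.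
Qed.

Let SH'_ABRR mu : theta mu (etat mu - pair alpha mu) * SH' mu = fam_mul SH' RH mu.
Proof.
rewrite (@fam_mul_map _ _ _ toH S' RB SH' RH) ?raddf0 //.
- by rewrite -S'_ABRR toHM toH_qpowh pairingDr opprD addrACA.
- by move=> x y; rewrite raddfD.
Qed.

Let SH'_weight mu :
  SH' mu * (1 \ox HK i) = qpow hbar (pair alpha mu) *: ((1 \ox HK i) * SH' mu).
Proof.
have toHZ c x : toH (c *: x) = c *: toH x by exact: linearZ.
have := congr1 toH (S'_weight mu); rewrite toHM toHZ toHM.
by have -> : toH (1 \ox BK i) = 1 \ox HK i by rewrite /toH /= tens_map_pure.
Qed.

Let A mu := G * SH mu.
Let D mu := SH' (mu - alpha) * E + SH' mu * G.

Let cone_sub mu : ~~ in_cone mu -> ~~ in_cone (mu - alpha).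
Proof. by apply: contraNN => c; rewrite -[mu](subrK alpha) coneD // cone_simple. Qed.

Let A_ABRR mu : theta mu (etat mu - pair alpha mu) * A mu = fam_mul A RH mu.
Proof.
rewrite (@fam_mul_map _ _ _ (fun x => G * x) SH RH A RH) ?mulr0 //.
- rewrite -SH_ABRR /A !mulrA; congr (_ * _); rewrite !tpureM !mulr1; congr (_ \ox _).
  rewrite (qpowh_twist (H_KV B hbar X) (H_VK B hbar X) _ _
    (fun j => rel_Ke (Uhat_Uq_rel B hbar X) j i)).
  rewrite -pairing_sum // ascalerAr qpowh_shift.
  by congr (_ * qpowh _ _ _ _ _); rewrite pairingDr; ring.
- by move=> x y; rewrite mulrDr.
- by move=> nu; rewrite mulrA.
Qed.

Let D_ABRR mu : theta mu (etat mu - pair alpha mu) * D mu = fam_mul D RH mu.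
Proof.
rewrite (fam_mul_intertwine (E' := Pe B hbar i \ox HK i) mu (cone_simple i)
  SH'_supported RH_supported); last exact: (RH_intertwines X hDelta hDeltat hRc).
rewrite /D mulrDr !mulrA SH'_ABRR; congr (_ + _).
rewrite -SH'_ABRR.
(* What remains is the term with S'_(mu - alpha). Moving K_alpha^2 to its left gives q^(2 (alpha, mu
   - alpha)) and turns 2 h_(mu - alpha) into 2 h_mu. The constants then add up to those of the
   shifted equation at mu. *)
have KKV : Pe B hbar i \ox HK i = (1 \ox HK i) * ((1 \ox HK i) * E) :> tens Uplus Uhat.
  by rewrite !tpureM !mul1r H_KV mulr1.
rewrite KKV [RHS](tens_twist_square _ _ (SH'_weight _)); congr (_ * _ * _).
rewrite !tpureM !mul1r -tpureZr; congr (_ \ox _).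
rewrite -(qpowh_simple hbar HK HV i).
rewrite !(qpowhD hbar (H_KV B hbar X) (H_VK B hbar X) (H_KK B hbar X)) -qpowD.
rewrite qpowh_shift; congr (qpowh _ _ _ _ _).
  by rewrite addrACA; apply/rowP => j; rewrite !mxE; ring.
rewrite (etat_sub R _ _ hPhi) pairingDr pairingNr (pairing_sym R _ alpha sB); ring.
Qed.

Lemma e_Stilde mu : A mu = D mu.
Proof.
suff -> : A = D by [].
apply: (fam_mul_unique (R := RH) (theta' := fun nu => toH (1 \ox ((q - q^-1)^-1 *:
    (inverse_of (qbrack hbar BK BV nu (etat nu - pair alpha nu))
     * qpowh hbar BK BV (- nu) (- (etat nu - pair alpha nu))))))
   (theta := fun nu => theta nu (etat nu - pair alpha nu))) => //.
- by move=> nu /SH_supported; rewrite /A => ->; rewrite mulr0.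
- move=> nu nc; rewrite /D (SH'_supported (cone_sub nc)) (SH'_supported nc).
  by rewrite !mul0r addr0.
- by rewrite /RH (RB0 X hRc) toH1.
- move=> nu cnu nu0; rewrite -toH_qpowh.
  rewrite -toH1 -raddfB -toHM; congr (toH _).
  rewrite -tpure11 -tpureNr -tpureDr tpureM mul1r.
  (* The shifted constant is still invertible in the localization because [X] is stable under adding
     values of the pairing. *)
  have Xc : X (- (etat nu - pair alpha nu)).
    by rewrite opprB addrC; apply: hX.2; apply: (hX.1 nu cnu nu0).2.
  have [b b1 b2] := @qbrack_invertible R n B hbar X _ _ cnu nu0 Xc.
  rewrite (qpowh_sub1_inverse (B_KV B hbar X) (B_VK B hbar X) (B_KK B hbar X) q_neq0) //.
  exact: (inverse_ofP b1 b2).2.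
(* At 0 the first term of [D] vanishes because -alpha lies outside the cone; both sides reduce to 1
   (x) e_alpha. *)
- rewrite /A /D SH'_supported; last first.
    apply/forallP => /(_ i); rewrite !mxE !eqxx.
    by [].
  by rewrite /SH /SH' Stilde0 S'0 toH1 mul0r add0r mulr1 mul1r.
Qed.

End Shift.

End Main.

Theorem proposition5p4
  (R : realType)
  (* semisimple Lie algebra: rank, Gram matrix of Pi, root system *)
  (n : nat) (B : 'M[rat]_n) (Phi : seq (lattice n))
  (hPhi : root_datum B Phi)
  (* q = exp hbar is not a root of unity *)
  (hbar : complex R)
  (hq : forall m : nat, (0 < m)%N -> qpow hbar 1 ^+ m != 1)
  (* constants of the localization *)
  (X : set (complex R)) (hX : admissible B X Phi)
  (* the comultiplications Delta and \tilde Delta, and \check R *)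
  (Delta Deltat : U B hbar -> tensA (U B hbar) (U B hbar))
  (hDelta : is_comult (@UK R n B hbar) (@UV R n B hbar) Delta)
  (hDeltat : is_comult (@UV R n B hbar) (@UK R n B hbar) Deltat)
  (Rc : lattice n -> tens (Uplus B hbar) (Uminus B hbar))
  (hRc : is_Rcheck Delta Deltat Rc)
  (* alpha in Pi, tau_alpha and its inverse *)
  (i : 'I_n)
  (tau tauV : {linear Bhat B hbar X -> Bhat B hbar X})
  (htau : is_shift (coords (complex R) (simple i)) tau)
  (htauK : cancel tau tauV) (htauVK : cancel tauV tau) :
  fam_mul (fam_single 0 (1 \ox He B hbar X i))
          (to_Uhat (Stilde X Phi Rc))
  = fam_mul (to_Uhat (fun mu => tens_map idfun tauV (Stilde X Phi Rc mu)))
            (Dtilde_e B hbar X i).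
Proof.
apply/funext => mu; rewrite fam_mul_single0l /Dtilde_e.
rewrite fam_mul_two_r ?simple_neq0 //.
exact: (e_Stilde hPhi hq hX hDelta hDeltat hRc htau htauK htauVK mu).
Qed.
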